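(* Suppose that $p=1$ or $p\ge1.5$. Let $(\mathbf Y_k)_{k\ge1}$ be a finite sequence of independent random matrices in $\mathbb H^d$ and let $(\mathbf A_k)_{k\ge1}$ be a sequence of deterministic matrices in $\mathbb H^d$ (with the same index set) for which $$\mathbb E\,\mathbf Y_k=\mathbf 0\quad\text{and}\quad\mathbf Y_k^2\preccurlyeq\mathbf A_k^2\qquad\text{almost surely for each index }k.$$ Then $$\Big(\mathbb E\Big\|\sum_k\mathbf Y_k\Big\|_{2p}^{2p}\Big)^{1/(2p)}\le\sqrt{p-0.5}\cdot\Big\|\Big(\sum_k\big(\mathbf A_k^2+\mathbb E\,\mathbf Y_k^2\big)\Big)^{1/2}\Big\|_{2p}.$$ In particular, when $(\varepsilon_k)_{k\ge1}$ is an independent sequence of Rademacher random variables, $$\Big(\mathbb E\Big\|\sum_k\varepsilon_k\mathbf A_k\Big\|_{2p}^{2p}\Big)^{1/(2p)}\le\sqrt{2p-1}\cdot\Big\|\Big(\sum_k\mathbf A_k^2\Big)^{1/2}\Big\|_{2p}.$$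
   Context: $\mathbb H^d$ is the space of $d\times d$ complex Hermitian matrices; $\mathbf A\preccurlyeq\mathbf B$ means $\mathbf B-\mathbf A$ is positive semidefinite. For $p\ge1$, the Schatten $p$-norm of a $d\times d$ complex matrix is $\|\mathbf B\|_p=(\mathrm{tr}\,|\mathbf B|^p)^{1/p}$ with $|\mathbf B|=(\mathbf B^*\mathbf B)^{1/2}$. A Rademacher random variable takes the values $\pm1$ with probability $1/2$ each. *)

(* Defs.v *)
From HB Require Import structures.
From mathcomp Require Import all_boot all_order all_algebra.
From mathcomp Require Import complex.
From mathcomp Require Import all_classical all_reals all_analysis.

Set Implicit Arguments.
Unset Strict Implicit.
Unset Printing Implicit Defensive.

Import Order.TTheory GRing.Theory Num.Theory.

Local Open Scope classical_set_scope.
Local Open Scope sesquilinear_scope.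
Local Open Scope complex_scope.
Local Open Scope ring_scope.

HB.instance Definition _ (R : realType) := isPointed.Build R[i] 0.

Section matrices.
Context {R : realType} {d : nat}.
Implicit Types A B : 'M[R[i]]_d.

(* The order on R[i] is the partial one: [0 <= z] says that z is real and
   nonnegative. *)
Definition psdmx A : Prop :=
  A \is hermsymmx /\ forall v : 'cV[R[i]]_d, 0 <= (v^t* *m A *m v) 0 0.

Definition loewner_le A B : Prop := psdmx (B - A).

(* Functional calculus: a normal A equals
   [invmx (spectralmx A) *m diag_mx (spectral_diag A) *m spectralmx A] with
   [spectralmx A] unitary (orthomx_spectralP), and the diagonal is real when A
   is Hermitian.  The value is meaningful for Hermitian A only. *)
Definition mxfun (f : R -> R) A : 'M[R[i]]_d :=
  invmx (spectralmx A)
    *m diag_mx (map_mx (fun z => (f (complex.Re z))%:C) (spectral_diag A))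
    *m spectralmx A.

Definition sqrtmx A : 'M[R[i]]_d := mxfun (@Num.sqrt R) A.

Definition absmx B : 'M[R[i]]_d := sqrtmx (B^t* *m B).

(* The trace of [|B|^p] is real, so taking its real part only changes the
   type. *)
Definition schatten (p : R) B : R :=
  (complex.Re (\tr (mxfun (fun x => x `^ p) (absmx B)))) `^ p^-1.

End matrices.

Section random_matrices.
Context (R : realType) (d : nat).

Definition mx_cylinders : set (set 'M[R[i]]_d) :=
  [set C | exists i j (B : set R), measurable B /\
     (C = [set M : 'M[R[i]]_d | B (complex.Re (M i j))] \/
      C = [set M : 'M[R[i]]_d | B (complex.Im (M i j))])].

End random_matrices.

(* 'M[R[i]]_d with the sigma-algebra generated by the real and imaginary parts
   of the entries, that is, its Borel sigma-algebra. *)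
Notation borelmx R d := (g_sigma_algebraType (@mx_cylinders R d)).

Section probability.
Context (R : realType) disp (T : measurableType disp) (P : probability T R).

(* [fine] maps an infinite expectation to 0, so the value is meaningful only if
   the entries of Y are integrable. *)
Definition mx_expectation d (Y : T -> 'M[R[i]]_d) : 'M[R[i]]_d :=
  \matrix_(i, j) (fine ('E_P[fun w => complex.Re (Y w i j)])%E +i*
                  fine ('E_P[fun w => complex.Im (Y w i j)])%E).

Definition mutually_independent (I : finType) disp' (U : measurableType disp')
    (X : I -> {RV P >-> U}) : Prop :=
  forall (J : {set I}) (B : I -> set U), (forall i, measurable (B i)) ->
    P [set w | forall i, i \in J -> B i (X i w)] =
    (\prod_(i in J) P (X i @^-1` B i))%E.

Definition rademacher (X : {RV P >-> R}) : Prop :=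
  P [set w | X w = 1] = (1 / 2)%:E /\ P [set w | X w = -1] = (1 / 2)%:E.

End probability.

Notation "A '≼' B" := (loewner_le A B) (at level 70, no associativity)
  : ring_scope.

(* Main.v *)
Require Import Defs.
From HB Require Import structures.
From mathcomp Require Import all_boot all_order all_algebra complex.
From mathcomp Require Import all_classical all_reals all_analysis.
From mathcomp Require Import measurable_realfun.
From mathcomp Require Import ring lra.

(** Write [X] for the sum of the [Y_k], [F x = x |x|^(2p-2)] and
    [psi x = |x|^(2p-2)], so that [E tr |X|^(2p)] is the sum over [k] of
    [E tr Y_k F(X)].  Put [X = Y_k + S] and let [X' = Y_k' + S] use an
    independent copy of [Y_k].  Since [Y_k] is centered,
    [2 E tr Y_k F(X) = E tr (Y_k - Y_k') (F(X) - F(X'))], and the mean value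
    trace inequality (the Hermite-Hadamard inequality for [psi], which is convex
    exactly when [p = 1] or [p >= 3/2], applied to pairs of eigenvalues) bounds
    this by [(p - 1/2) E tr (Y_k - Y_k')^2 (psi X + psi X')], which is
    [2 (p - 1/2) E tr (Y_k^2 + E Y_k^2) psi(X)].
    Summing, with [c = p - 1/2] and [B] the sum of the [A_k^2 + E Y_k^2],
    [E tr |X|^(2p) <= E tr (c B) psi(X)
       <= c^p tr B^p / p + (1 - 1/p) E tr |X|^(2p)]
    by Young's inequality for the trace, hence
    [E tr |X|^(2p) <= c^p tr B^p].

    All trace inequalities come from one formula: for Hermitian [A], [B] there
    are weights [W i j >= 0] with
    [tr f(A) g(B) = sum_(i, j) f(a_i) g(b_j) W i j] for all [f] and [g]. *)

Set Implicit Arguments.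
Unset Strict Implicit.
Unset Printing Implicit Defensive.

Import Order.TTheory GRing.Theory Num.Theory.
Import numFieldNormedType.Exports.

Local Open Scope classical_set_scope.
Local Open Scope sesquilinear_scope.
Local Open Scope complex_scope.
Local Open Scope ring_scope.

(** * Traces and functional calculus of Hermitian matrices *)

(** The integrand is a spectral function of a random matrix, while [spectralmx] comes from a choice
    of eigenbasis that need not depend measurably on the matrix. Measurability is recovered from a
    Hilbert-Schmidt Lipschitz estimate and rounding to a countable set of matrices. The dichotomy on
    [p] enters through [q = 2 * p - 2], which is 0 or at least 1: there |x|^q is convex and also
    Lipschitz on bounded sets. The constant p - 1/2 is (q + 1) / 2, with q + 1 from differentiating
    x |x|^q and 1/2 from the trapezoid rule. The independent copy is never built as a random
    variable: it is a second sample point, integrated separately. Absorbing (1 - 1/p) E tr |X|^(2p)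
    requires this moment to be finite, so the main estimate is proved for bounded matrices; the
    bound of Y_k^2 by A_k^2 provides such matrices after a change on a null set that keeps
    independence. *)

Section complex_parts.
Context {R : realType}.
Implicit Types x y : R[i].

Lemma cReD x y : complex.Re (x + y) = complex.Re x + complex.Re y.
Proof. by case: x y => [? ?] []. Qed.

Lemma cImD x y : complex.Im (x + y) = complex.Im x + complex.Im y.
Proof. by case: x y => [? ?] []. Qed.

Lemma cReN x : complex.Re (- x) = - complex.Re x.
Proof. by case: x. Qed.

Lemma cImN x : complex.Im (- x) = - complex.Im x.
Proof. by case: x. Qed.

Lemma cReM x y :
  complex.Re (x * y) = complex.Re x * complex.Re y - complex.Im x * complex.Im y.
Proof. by case: x y => [? ?] []. Qed.

Lemma cImM x y :
  complex.Im (x * y) = complex.Re x * complex.Im y + complex.Im x * complex.Re y.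
Proof. by case: x y => [a b] [c e] /=. Qed.

Lemma cRe_conj x : complex.Re (x ^*)%R = complex.Re x.
Proof. by case: x. Qed.

Lemma cIm_conj x : complex.Im (x ^*)%R = - complex.Im x.
Proof. by case: x. Qed.

Lemma cReZ (c : R) x : complex.Re (c%:C * x) = c * complex.Re x.
Proof. by rewrite cReM /= mul0r subr0. Qed.

Lemma cRe_sum I (r : seq I) (P : pred I) (F : I -> R[i]) :
  complex.Re (\sum_(i <- r | P i) F i) = \sum_(i <- r | P i) complex.Re (F i).
Proof. by apply: (big_morph _ cReD). Qed.

Lemma cIm_sum I (r : seq I) (P : pred I) (F : I -> R[i]) :
  complex.Im (\sum_(i <- r | P i) F i) = \sum_(i <- r | P i) complex.Im (F i).
Proof. by apply: (big_morph _ cImD). Qed.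

Lemma complex_eqP x y :
  complex.Re x = complex.Re y -> complex.Im x = complex.Im y -> x = y.
Proof. by case: x y => [? ?] [? ?] /= -> ->. Qed.

End complex_parts.

Definition rtr (R : realType) d (M : 'M[R[i]]_d) : R := complex.Re (\tr M).
(** The squared Hilbert-Schmidt norm: it dominates entries and eigenvalues alike, so it measures all
    sizes and distances of matrices below. *)
Definition hsq (R : realType) d (M : 'M[R[i]]_d) : R := rtr (M^t* *m M).

(* Sealed: otherwise unification unfolds [mxfun] down to the choice operators
   behind [spectralmx]. *)
HB.lock Definition fcalc (R : realType) d (f : R -> R) (A : 'M[R[i]]_d) :
  'M[R[i]]_d := mxfun f A.

Section spectral_calculus.
Context {R : realType} {d : nat}.
Implicit Types (A B X M N : 'M[R[i]]_d) (f g h : R -> R).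

Lemma rtrD M N : rtr (M + N) = rtr M + rtr N.
Proof. by rewrite /rtr mxtraceD cReD. Qed.

Lemma rtrN M : rtr (- M) = - rtr M.
Proof. by rewrite /rtr raddfN /= cReN. Qed.

Lemma rtrB M N : rtr (M - N) = rtr M - rtr N.
Proof. by rewrite rtrD rtrN. Qed.

Lemma rtrZ (c : R) M : rtr (c%:C *: M) = c * rtr M.
Proof. by rewrite /rtr mxtraceZ cReZ. Qed.

Lemma rtr_mulC M N : rtr (M *m N) = rtr (N *m M).
Proof. by rewrite /rtr mxtrace_mulC. Qed.

Lemma rtr_sum I (r : seq I) (P : pred I) (F : I -> 'M[R[i]]_d) :
  rtr (\sum_(i <- r | P i) F i) = \sum_(i <- r | P i) rtr (F i).
Proof. by apply: (big_morph _ rtrD); rewrite /rtr mxtrace0. Qed.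

Lemma adjmxE M i j : M^t* i j = ((M j i)^*)%R.
Proof. by rewrite !mxE. Qed.

Lemma adjmxM M N : (M *m N)^t* = N^t* *m M^t*.
Proof. by rewrite trmx_mul map_mxM. Qed.

Lemma adjmxD M N : (M + N)^t* = M^t* + N^t*.
Proof. by rewrite !raddfD. Qed.

Lemma adjmxB M N : (M - N)^t* = M^t* - N^t*.
Proof. by rewrite !raddfB. Qed.

Lemma adjmxZ (c : R) M : (c%:C *: M)^t* = c%:C *: M^t*.
Proof.
by apply/matrixP => i j; rewrite !mxE rmorphM; congr (_ * _); exact: conjc_real.
Qed.

Lemma hermsymmxE A : (A \is hermsymmx) = (A == A^t*).
Proof. by rewrite is_hermitianmxE expr0 scale1r. Qed.

Lemma hermsymmx_adj A : A \is hermsymmx -> A^t* = A.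
Proof. by rewrite hermsymmxE => /eqP <-. Qed.

Lemma hermsymmxD A B :
  A \is hermsymmx -> B \is hermsymmx -> A + B \is hermsymmx.
Proof.
by move=> hA hB; rewrite hermsymmxE adjmxD !hermsymmx_adj.
Qed.

Lemma hermsymmxZ (c : R) A : A \is hermsymmx -> c%:C *: A \is hermsymmx.
Proof. by move=> hA; rewrite hermsymmxE adjmxZ hermsymmx_adj. Qed.

Lemma hermsymmx0 : (0 : 'M[R[i]]_d) \is hermsymmx.
Proof. by rewrite hermsymmxE trmx0 map_mx0. Qed.

Lemma hermsymmx_sum I (r : seq I) (P : pred I) (F : I -> 'M[R[i]]_d) :
  (forall i, P i -> F i \is hermsymmx) ->
  \sum_(i <- r | P i) F i \is hermsymmx.
Proof.
move=> hF; rewrite hermsymmxE; apply/eqP.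
have Z : (0 : 'M[R[i]]_d)^t* = 0 by rewrite trmx0 map_mx0.
rewrite (big_morph (fun M : 'M[R[i]]_d => M^t*) adjmxD Z).
by apply: eq_bigr => i /hF /hermsymmx_adj.
Qed.

Lemma hermsymmx_sqr A : A \is hermsymmx -> A *m A \is hermsymmx.
Proof. by move=> hA; rewrite hermsymmxE adjmxM !hermsymmx_adj. Qed.

Lemma hsqE M :
  hsq M = \sum_i \sum_j (complex.Re (M i j) ^+ 2 + complex.Im (M i j) ^+ 2).
Proof.
rewrite exchange_big /= /hsq /rtr /mxtrace cRe_sum; apply: eq_bigr => i _.
rewrite mxE cRe_sum; apply: eq_bigr => j _.
by rewrite adjmxE cReM cRe_conj cIm_conj; ring.
Qed.

Lemma hsq_ge0 M : 0 <= hsq M.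
Proof.
by rewrite hsqE; do 2 (apply: sumr_ge0 => ? _); rewrite addr_ge0 ?sqr_ge0.
Qed.

Lemma entry_le_hsq M i j :
  complex.Re (M i j) ^+ 2 + complex.Im (M i j) ^+ 2 <= hsq M.
Proof.
rewrite hsqE (bigD1 i) //= (bigD1 j) //= -addrA lerDl addr_ge0 //.
  by apply: sumr_ge0 => ? _; rewrite addr_ge0 ?sqr_ge0.
by do 2 (apply: sumr_ge0 => ? _); rewrite addr_ge0 ?sqr_ge0.
Qed.

Lemma hsq_eq0 M : hsq M = 0 -> M = 0.
Proof.
move=> M0; apply/matrixP => i j; have := entry_le_hsq M i j.
rewrite M0 mxE => h; apply: complex_eqP => /=; nra.
Qed.

(** The adjoint replaces the inverse in [mxfun], and the diagonal is a real function of the index;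
    two such matrices with different [U] can then be multiplied under the trace. *)
Definition unitdiag (U : 'M[R[i]]_d) (a : 'I_d -> R) : 'M[R[i]]_d :=
  U^t* *m diag_mx (\row_i (a i)%:C) *m U.

Lemma adjmx_unitdiag U a : (unitdiag U a)^t* = unitdiag U a.
Proof.
rewrite /unitdiag !adjmxM trmxCK mulmxA.
have -> : (diag_mx (\row_i (a i)%:C))^t* = diag_mx (\row_i (a i)%:C); last by [].
apply/matrixP => i j; rewrite !mxE eq_sym; case: eqP => [->|_].
  by rewrite !mulr1n; exact: conjc_real.
by rewrite !mulr0n rmorph0.
Qed.

Lemma unitdiagM U a b : U \is unitarymx ->
  unitdiag U a *m unitdiag U b = unitdiag U (fun i => a i * b i).
Proof.
have conjM (V D E : 'M[R[i]]_d) : U *m V = 1%:M ->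
    (V *m D *m U) *m (V *m E *m U) = V *m (D *m E) *m U.
  by move=> UV; rewrite -!mulmxA (mulmxA U) UV mul1mx.
move=> /unitarymxP/conjM hU; rewrite /unitdiag hU.
have -> : diag_mx (\row_i (a i)%:C) *m diag_mx (\row_i (b i)%:C) =
    diag_mx (\row_i (a i * b i)%:C); last by [].
by apply/matrixP => i j; rewrite mulmx_diag !mxE rmorphM.
Qed.

Lemma unitdiag1 U : U \is unitarymx -> unitdiag U (fun=> 1) = 1%:M.
Proof.
move=> hU; rewrite /unitdiag (_ : diag_mx _ = 1%:M); last first.
  by apply/matrixP => i j; rewrite !mxE.
by rewrite mulmx1 -invmx_unitary // mulVmx // unitarymx_unit.
Qed.

Lemma unitdiagZ (c : R) U a :
  c%:C *: unitdiag U a = unitdiag U (fun i => c * a i).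
Proof.
rewrite /unitdiag scalemxAl scalemxAr.
have -> : c%:C *: diag_mx (\row_i (a i)%:C) = diag_mx (\row_j (c * a j)%:C).
  2: by [].
by apply/matrixP => i j; rewrite !mxE rmorphM mulrnAr.
Qed.

(** Cyclicity of the trace leaves the two diagonals separated by [W = U *m V^t*] and its adjoint, so
    each product of diagonal entries is paired with a squared modulus of an entry of [W]. *)
Lemma rtr_unitdiag2 U V a b : rtr (unitdiag U a *m unitdiag V b) =
  \sum_i \sum_j a i * b j * (complex.Re ((U *m V^t*) i j) ^+ 2 +
                             complex.Im ((U *m V^t*) i j) ^+ 2).
Proof.
rewrite /unitdiag -!mulmxA rtr_mulC !mulmxA.
rewrite -(mulmxA _ U (V^t*)) -(mulmxA _ V (U^t*)).
have -> : V *m U^t* = (U *m V^t*)^t* by rewrite adjmxM trmxCK.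
move: (U *m V^t*) => W; rewrite -mulmxA /rtr /mxtrace cRe_sum.
apply: eq_bigr => i _; rewrite mxE cRe_sum; apply: eq_bigr => j _.
rewrite !mul_diag_mx !mxE.
rewrite !cReM !cImM cRe_conj cIm_conj /=; ring.
Qed.

Let eig A i : R := complex.Re (spectral_diag A 0 i).

Let fcalcE f A : fcalc f A = unitdiag (spectralmx A) (fun i => f (eig A i)).
Proof.
rewrite fcalc.unlock /mxfun /eig /unitdiag.
move: (spectralmx A) (spectral_diag A) (spectral_unitarymx A) => U v hU.
have -> : map_mx (fun z => (f (complex.Re z))%:C) v =
    \row_i (f (complex.Re (v 0 i)))%:C.
  by apply/rowP => i; rewrite !mxE.
by rewrite invmx_unitary.
Qed.

Lemma adjmx_fcalc f A : (fcalc f A)^t* = fcalc f A.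
Proof. by rewrite fcalcE adjmx_unitdiag. Qed.

Lemma fcalc_herm f A : fcalc f A \is hermsymmx.
Proof. by rewrite hermsymmxE adjmx_fcalc. Qed.

Lemma fcalcM f g A : fcalc f A *m fcalc g A = fcalc (fun x => f x * g x) A.
Proof. by rewrite !fcalcE unitdiagM ?spectral_unitarymx. Qed.

Lemma fcalc_id A : A \is hermsymmx -> fcalc id A = A.
Proof.
move=> hA; have /hermitian_normalmx/orthomx_spectralP {2}-> := hA.
have := hermitian_spectral_diag_real hA; rewrite fcalc.unlock /mxfun.
move: (spectralmx A) (spectral_diag A) => U v /mxOverP hv.
have -> : map_mx (fun z => (complex.Re z)%:C) v = v; last by [].
by apply/rowP => i; rewrite mxE; apply: RRe_real; exact: hv.
Qed.

Lemma fcalc1 A : fcalc (fun=> 1) A = 1%:M.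
Proof. by rewrite fcalcE unitdiag1 ?spectral_unitarymx. Qed.

Lemma fcalcZ (c : R) A : A \is hermsymmx ->
  c%:C *: A = fcalc (fun x => c * x) A.
Proof. by move=> hA; rewrite -{1}(fcalc_id hA) !fcalcE unitdiagZ. Qed.

Let weight A B i j : R :=
  complex.Re ((spectralmx A *m (spectralmx B)^t*) i j) ^+ 2 +
  complex.Im ((spectralmx A *m (spectralmx B)^t*) i j) ^+ 2.

Let rtr_fcalc2 f g A B : rtr (fcalc f A *m fcalc g B) =
  \sum_i \sum_j f (eig A i) * g (eig B j) * weight A B i j.
Proof. by rewrite !fcalcE rtr_unitdiag2. Qed.

Let weight_id A i j : weight A A i j = (i == j)%:R.
Proof.
rewrite /weight; have /unitarymxP -> := spectral_unitarymx A.
by rewrite mxE; case: (i == j) => /=; rewrite ?expr1n ?expr0n ?addr0.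
Qed.

(** The square of one eigenvalue is a term of the sum of all squares, which is [hsq A]. *)
Let eig_bound A : A \is hermsymmx ->
  forall i, `|eig A i| <= Num.sqrt (hsq A).
Proof.
move=> hA i; rewrite -sqrtr_sqr ler_wsqrtr // /hsq hermsymmx_adj //.
rewrite -{2 3}(fcalc_id hA) rtr_fcalc2 (bigD1 i) //= (bigD1 i) //=.
rewrite weight_id eqxx mulr1 -expr2 -addrA lerDl addr_ge0 //.
  apply: sumr_ge0 => j ji; rewrite weight_id eq_sym (negbTE ji) mulr0 //.
do 2 (apply: sumr_ge0 => ? _); rewrite weight_id.
by case: eqP => [->|_]; rewrite ?mulr0 // mulr1 -expr2 sqr_ge0.
Qed.

(** Traces of products of functions of [A] and [B] all become such sums with common [a], [b], [W],
    so an inequality between them reduces to a scalar inequality at each pair [a i], [b j]. *)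
Definition wsum (a b : 'I_d -> R) (W : 'I_d -> 'I_d -> R)
  (h : R -> R -> R) : R := \sum_i \sum_j h (a i) (b j) * W i j.

Lemma wsumD a b W (h1 h2 : R -> R -> R) :
  wsum a b W h1 + wsum a b W h2 = wsum a b W (fun x y => h1 x y + h2 x y).
Proof.
rewrite -big_split; apply: eq_bigr => i _; rewrite -big_split.
by apply: eq_bigr => j _; rewrite mulrDl.
Qed.

Lemma wsumZ a b W (c : R) (h : R -> R -> R) :
  c * wsum a b W h = wsum a b W (fun x y => c * h x y).
Proof.
rewrite mulr_sumr; apply: eq_bigr => i _; rewrite mulr_sumr.
by apply: eq_bigr => j _; rewrite mulrA.
Qed.

Lemma wsumN a b W (h : R -> R -> R) : - wsum a b W h = wsum a b W (fun x y => - h x y).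
Proof.
rewrite -mulN1r wsumZ; apply: eq_bigr => i _; apply: eq_bigr => j _.
by rewrite mulN1r.
Qed.

Lemma eq_wsum a b W (h1 h2 : R -> R -> R) : (forall i j, h1 (a i) (b j) = h2 (a i) (b j)) ->
  wsum a b W h1 = wsum a b W h2.
Proof.
by move=> h; apply: eq_bigr => i _; apply: eq_bigr => j _; rewrite h.
Qed.

Lemma le_wsum a b W (h1 h2 : R -> R -> R) : (forall i j, 0 <= W i j) ->
  (forall i j, h1 (a i) (b j) <= h2 (a i) (b j)) ->
  wsum a b W h1 <= wsum a b W h2.
Proof.
move=> W0 h; apply: ler_sum => i _; apply: ler_sum => j _.
by rewrite ler_wpM2r.
Qed.

(* The weights are the squared moduli of the inner products of two
   eigenbases. *)
Lemma joint_spectrum A B : A \is hermsymmx -> B \is hermsymmx ->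
  exists (a b : 'I_d -> R) (W : 'I_d -> 'I_d -> R),
  [/\ forall i j, 0 <= W i j,
      forall i, `|a i| <= Num.sqrt (hsq A),
      forall i, `|b i| <= Num.sqrt (hsq B)
    & forall f g, rtr (fcalc f A *m fcalc g B) =
        wsum a b W (fun x y => f x * g y)].
Proof.
move=> hA hB; exists (eig A), (eig B), (weight A B); split.
- by move=> i j; rewrite addr_ge0 ?sqr_ge0.
- exact: eig_bound.
- exact: eig_bound.
- by move=> f g; exact: rtr_fcalc2.
Qed.

End spectral_calculus.

(** * Trace inequalities for two Hermitian matrices *)

Section trace_inequalities.
Context {R : realType} {d : nat}.
Implicit Types (A B X M N D : 'M[R[i]]_d) (f g h : R -> R).

Lemma rtr_fcalcM f g A : rtr (fcalc f A *m fcalc g A) =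
  rtr (fcalc (fun x => f x * g x) A).
Proof. by rewrite fcalcM. Qed.

(** Padding with the identity puts the trace of a function of one matrix on the same double sum as
    the mixed traces. *)
Lemma rtr_fcalcl f A B :
  rtr (fcalc f A) = rtr (fcalc f A *m fcalc (fun=> 1) B).
Proof. by rewrite fcalc1 mulmx1. Qed.

Lemma rtr_fcalcr f A B :
  rtr (fcalc f B) = rtr (fcalc (fun=> 1) A *m fcalc f B).
Proof. by rewrite fcalc1 mul1mx. Qed.

Lemma hsqB_herm M N : M \is hermsymmx -> N \is hermsymmx ->
  hsq (M - N) = rtr (M *m M) - 2 * rtr (M *m N) + rtr (N *m N).
Proof.
move=> hM hN; rewrite /hsq adjmxB !hermsymmx_adj // mulmxBl !mulmxBr !rtrB.
rewrite (rtr_mulC N M); ring.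
Qed.

Lemma hsq_fcalcB A B : A \is hermsymmx -> B \is hermsymmx ->
  exists (a b : 'I_d -> R) (W : 'I_d -> 'I_d -> R),
  [/\ forall i j, 0 <= W i j,
      forall i, `|a i| <= Num.sqrt (hsq A),
      forall i, `|b i| <= Num.sqrt (hsq B)
    & forall f g, hsq (fcalc f A - fcalc g B) =
        wsum a b W (fun x y => (f x - g y) ^+ 2)].
Proof.
move=> hA hB; have [a [b [W [W0 ha hb E]]]] := joint_spectrum hA hB.
exists a, b, W; split=> // f g.
rewrite (hsqB_herm (fcalc_herm f A) (fcalc_herm g B)) !fcalcM.
rewrite (rtr_fcalcl _ A B) (rtr_fcalcr _ A B) !E.
rewrite wsumZ wsumN !wsumD; apply: eq_wsum => i j; ring.
Qed.

(** The eigenbasis that [spectralmx] picks for [fcalc f A] need not be the one for [A], so unfolding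
    does not suffice. Instead the distance from [fcalc f A] to itself, written over both bases, is a
    vanishing sum of nonnegative terms: wherever the weight is nonzero, [f (a i) = b j], hence also
    [g (f (a i)) = g (b j)]. *)
Lemma fcalc_comp f g A : A \is hermsymmx ->
  fcalc g (fcalc f A) = fcalc (fun x => g (f x)) A.
Proof.
move=> hA; have hB := fcalc_herm f A.
have [a [b [W [W0 _ _ E]]]] := hsq_fcalcB hA hB.
apply/eqP; rewrite eq_sym -subr_eq0; apply/eqP/hsq_eq0; rewrite E.
have : hsq (fcalc f A - fcalc id (fcalc f A)) = 0.
  by rewrite fcalc_id // subrr /hsq mulmx0 /rtr mxtrace0.
have pos i j : 0 <= (f (a i) - b j) ^+ 2 * W i j by rewrite mulr_ge0 ?sqr_ge0.
rewrite E => /eqP; rewrite psumr_eq0 => [/allP E0|i _]; last exact: sumr_ge0.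
apply: big1 => i _; apply: big1 => j _.
have := E0 i (mem_index_enum i); rewrite implyTb => /eqP.
move=> /eqP; rewrite psumr_eq0 // => /allP /(_ j (mem_index_enum j)).
rewrite implyTb mulf_eq0 sqrf_eq0 subr_eq0 => /orP[/eqP <-|/eqP ->].
  by rewrite subrr expr0n mul0r.
by rewrite mulr0.
Qed.

Lemma eq_fcalc f g A : f =1 g -> fcalc f A = fcalc g A.
Proof. by move=> /funext ->. Qed.

(** The scalar Lipschitz bound is squared and summed against the weights; [K] covers both spectra
    because the Hilbert-Schmidt norms bound the eigenvalues. *)
Lemma hsq_fcalc_lip (L K : R) f A B :
  A \is hermsymmx -> B \is hermsymmx ->
  Num.sqrt (hsq A) <= K -> Num.sqrt (hsq B) <= K ->
  (forall x y, `|x| <= K -> `|y| <= K -> `|f x - f y| <= L * `|x - y|) ->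
  hsq (fcalc f A - fcalc f B) <= L ^+ 2 * hsq (A - B).
Proof.
move=> hA hB AK BK Lf; have [a [b [W [W0 ha hb E]]]] := hsq_fcalcB hA hB.
rewrite -{2}(fcalc_id hA) -{2}(fcalc_id hB) !E wsumZ; apply: le_wsum => // i j.
have := Lf _ _ (le_trans (ha i) AK) (le_trans (hb j) BK).
move=> h; have L0 := le_trans (normr_ge0 _) h.
have := lerXn2r 2 (normr_ge0 _) L0 h.
by rewrite exprMn !real_normK ?num_real.
Qed.

Lemma hsq_fcalc_le (C : R) f A : A \is hermsymmx ->
  (forall x, `|x| <= Num.sqrt (hsq A) -> `|f x| <= C) ->
  hsq (fcalc f A) <= C ^+ 2 * d%:R.
Proof.
move=> hA fC; have [a [b [W [W0 ha _ E]]]] := joint_spectrum hA hA.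
have -> : d%:R = rtr (1%:M : 'M[R[i]]_d).
  rewrite /rtr mxtrace1; elim: (d) => // n IH; rewrite -!natr1 IH cReD //.
rewrite -(fcalc1 A) /hsq adjmx_fcalc rtr_fcalcM !(rtr_fcalcl _ A A) !E wsumZ.
apply: le_wsum => // i j; rewrite !mulr1 -expr2 -real_normK ?num_real //.
by rewrite lerXn2r ?nnegrE ?fC // (le_trans _ (fC _ (ha i))).
Qed.

(** With [G] the square root of [fcalc f A], the trace is that of [G^t* *m D *m G], whose diagonal
    entries are the quadratic form of [D] at the columns of [G]. *)
Lemma rtr_psd_fcalc f A D : psdmx D -> (forall x, 0 <= f x) ->
  0 <= rtr (D *m fcalc f A).
Proof.
move=> [_ hD] f0; pose G := fcalc (Num.sqrt \o f) A.
have -> : fcalc f A = G *m G.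
  by rewrite fcalcM; apply: eq_fcalc => x /=; rewrite -expr2 sqr_sqrtr.
have GG : G^t* = G by exact: adjmx_fcalc.
rewrite mulmxA rtr_mulC mulmxA -{1}GG.
rewrite /rtr /mxtrace cRe_sum sumr_ge0 // => i _.
have := hD (col i G).
have -> : (((col i G)^t* *m D) *m col i G) 0 0 = (G^t* *m D *m G) i i.
  rewrite !mxE; apply: eq_bigr => k _; rewrite !mxE; congr (_ * _).
  by apply: eq_bigr => l _; rewrite !mxE.
by rewrite lecE => /andP[].
Qed.

Lemma psdmx_rtr_ge0 D : psdmx D -> 0 <= rtr D.
Proof.
by move=> hD; have := @rtr_psd_fcalc (fun=> 1) 0 D hD; rewrite fcalc1 mulmx1; apply.
Qed.

Lemma rtr_mulBB A B M N :
  rtr ((A - B) *m (M - N)) =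
  rtr (A *m M) - rtr (A *m N) - rtr (M *m B) + rtr (B *m N).
Proof. by rewrite mulmxBl !mulmxBr !rtrB (rtr_mulC B M); ring. Qed.

(** The terms are grouped for integration over a copy that carries [B] and [N]: each separates a
    factor in [A], [M] from a factor in [B], [N]. *)
Lemma rtr_sqrB_mulD A B M N :
  rtr ((A - B) *m (A - B) *m (M + N)) =
  (rtr (A *m A *m M) - rtr (B *m (M *m A)) - rtr (B *m (A *m M))
    + rtr (B *m B *m M)) +
  (rtr (A *m A *m N) - rtr (A *m (B *m N)) - rtr (A *m (N *m B))
    + rtr (B *m B *m N)).
Proof.
have -> : (A - B) *m (A - B) = A *m A - A *m B - B *m A + B *m B.
  by rewrite mulmxBl !mulmxBr opprB addrA addrAC.
rewrite mulmxDr !mulmxDl !mulNmx !(rtrD, rtrN).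
have -> : rtr (A *m B *m M) = rtr (B *m (M *m A)).
  by rewrite -mulmxA rtr_mulC mulmxA.
have -> : rtr (B *m A *m N) = rtr (A *m (N *m B)).
  by rewrite -mulmxA rtr_mulC mulmxA.
by rewrite -!mulmxA.
Qed.

(** Here [M] and [N] stand for functions of [A] and [B]; commutation turns every term into a
    function of [A] times a function of [B], the form that [joint_spectrum] evaluates. *)
Lemma rtr_sqrBD A B M N : comm_mx M A -> comm_mx N B ->
  rtr ((A - B) *m (A - B) *m (M + N)) =
  rtr (A *m (A *m M)) - 2 * rtr (A *m M *m B) + rtr (M *m (B *m B)) +
  rtr (A *m A *m N) - 2 * rtr (A *m (B *m N)) + rtr (B *m (B *m N)).
Proof.
move=> cA cB; rewrite rtr_sqrB_mulD cA cB.
rewrite (rtr_mulC B (A *m M)) (rtr_mulC (B *m B) M).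
by rewrite -(mulmxA A A M) -(mulmxA B B N); ring.
Qed.

(** Both traces are double sums over the same weights, with terms given by the two sides of the
    scalar hypothesis at [x = a i], [y = b j]. *)
Lemma fcalc_mean_value (c : R) f g A B :
  A \is hermsymmx -> B \is hermsymmx ->
  (forall x y, (x - y) * (f x - f y) <= c * ((x - y) ^+ 2 * (g x + g y))) ->
  rtr ((A - B) *m (fcalc f A - fcalc f B)) <=
  c * rtr ((A - B) *m (A - B) *m (fcalc g A + fcalc g B)).
Proof.
move=> hA hB fg; have [a [b [W [W0 _ _ E]]]] := joint_spectrum hA hB.
have jA u : A *m fcalc u A = fcalc (fun x => x * u x) A.
  by rewrite -{1}(fcalc_id hA) fcalcM.
have jB u : B *m fcalc u B = fcalc (fun x => x * u x) B.
  by rewrite -{1}(fcalc_id hB) fcalcM.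
have cA u : comm_mx (fcalc u A) A.
  rewrite /comm_mx -{2 3}(fcalc_id hA) !fcalcM.
  by apply: eq_fcalc => x; exact: mulrC.
have cB u : comm_mx (fcalc u B) B.
  rewrite /comm_mx -{2 3}(fcalc_id hB) !fcalcM.
  by apply: eq_fcalc => x; exact: mulrC.
have lA u : A *m fcalc u B = fcalc id A *m fcalc u B by rewrite fcalc_id.
have rB u : fcalc u A *m B = fcalc u A *m fcalc id B by rewrite fcalc_id.
have sA : A *m A = fcalc (fun x => x * x) A.
  by rewrite -[in LHS](fcalc_id hA) fcalcM.
have sB : B *m B = fcalc (fun x => x * x) B.
  by rewrite -[in LHS](fcalc_id hB) fcalcM.
rewrite rtr_mulBB (rtr_sqrBD (cA g) (cB g)) sA sB !jA !jB !lA !rB.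
rewrite !(rtr_fcalcl _ A B) !(rtr_fcalcr _ A B) !E !wsumZ.
rewrite !(wsumN, wsumD) wsumZ; apply: le_wsum => // i j.
by have := fg (a i) (b j); lra.
Qed.

End trace_inequalities.

(** * Inequalities for real powers *)

Section power_inequalities.
Context {R : realType}.
Implicit Types (a b x y : R).

Lemma powR_young (r a b : R) : 1 <= r -> 0 <= a -> 0 <= b ->
  a * b `^ (r - 1) <= a `^ r / r + (1 - r^-1) * b `^ r.
Proof.
move=> r1 a0 b0; have r0 : 0 < r by lra.
(* At [r = 1] the conjugate exponent [r / (r - 1)] is infinite. *)
have [r_eq1|r_neq1] := eqVneq r 1.
  by rewrite r_eq1 invr1 subrr mul0r addr0 mulr1 powRr0 mulr1 powRr1.
have r_gt1 : 0 < r - 1 by rewrite subr_gt0 lt_neqAle eq_sym r_neq1.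
have := @conjugate_powR R a (b `^ (r - 1)) r (r / (r - 1)) a0 (powR_ge0 _ _) r0.
rewrite divr_gt0 // -powRrM => /(_ isT).
have -> : (r - 1) * (r / (r - 1)) = r by field; rewrite gt_eqF.
have -> : (r / (r - 1))^-1 = 1 - r^-1 by field; rewrite !gt_eqF.
move=> /(_ _)/le_trans; apply; first by ring.
by rewrite [_ * (1 - _)]mulrC.
Qed.

(** Convexity of the power: its graph lies above the tangent at [b]. This is Young's inequality
    multiplied by [r]. *)
Lemma powR_tangent (r a b : R) : 1 <= r -> 0 <= a -> 0 <= b ->
  b `^ r - a `^ r <= r * b `^ (r - 1) * (b - a).
Proof.
move=> r1 a0 b0; have r0 : 0 < r by lra.
have := powR_young r1 a0 b0; rewrite -(ler_pM2l r0) => h.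
have -> : r * b `^ (r - 1) * (b - a) =
    r * (b * b `^ (r - 1)) - r * (a * b `^ (r - 1)) by ring.
rewrite mulr_powRB1 //.
have e : r * (a `^ r / r + (1 - r^-1) * b `^ r) = a `^ r + (r - 1) * b `^ r.
  by field; rewrite gt_eqF.
rewrite e in h; lra.
Qed.

(** The trapezoid rule overestimates the integral of the convex t^q from b to a. The gap is
    nondecreasing in the right endpoint: its derivative is (q + 1) / 2 times the excess, at b, of
    the power over its tangent at that endpoint. *)
Lemma powR_hermite_hadamard (q a b : R) : 1 <= q -> 0 <= b -> b <= a ->
  a `^ (q + 1) - b `^ (q + 1) <= (q + 1) / 2 * ((a - b) * (a `^ q + b `^ q)).
Proof.
move=> q1 b0 ba; have q0 : 0 < q by lra.
have a0 : 0 <= a by exact: le_trans ba.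
(* For positive [b] the closed interval avoids 0, which keeps the derivative formula for [powR]
   valid on all of it. *)
have [b_eq0|b_neq0] := eqVneq b 0.
  rewrite b_eq0 !powR0 ?gt_eqF //; last by lra.
  rewrite subr0 addr0 subr0 powRD; last by rewrite gt_eqF //; lra.
  have := powR_ge0 a q; rewrite powRr1 // => h.
  rewrite [a * _]mulrC -[leLHS]mul1r ler_wpM2r ?mulr_ge0 //; lra.
have {b_neq0} b0' : 0 < b by rewrite lt_neqAle eq_sym b_neq0.
pose G : R -> R := ((q + 1) / 2) *:
    ((id - cst b) * ((@powR R ^~ q) + cst (b `^ q))) - @powR R ^~ (q + 1).
pose dG t := (q + 1) / 2 * ((t `^ q + b `^ q) + (t - b) * (q * t `^ (q - 1)))
  - (q + 1) * t `^ q.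
have GdG (t : R) : 0 < t -> is_derive t 1 G (dG t).
  move=> t0; have := is_derive1_powR q t0; have := is_derive1_powR (q + 1) t0.
  move=> h1 h2; apply: is_derive_eq.
  change ((q + 1) / 2 * ((t - b) * (q * t `^ (q - 1) + 0) +
    (t `^ q + b `^ q) * (1 - 0)) - (q + 1) * t `^ (q + 1 - 1) = dG t).
  by rewrite /dG addrK; ring.
have [] := @MVT_segment R G dG b a ba.
- move=> t; rewrite in_itv /= => /andP[bt _]; exact/GdG/(lt_trans b0').
- apply: derivable_within_continuous => t; rewrite in_itv /= => /andP[bt _].
  by case: (GdG t (lt_le_trans b0' bt)).
move=> c; rewrite in_itv /= => /andP[bc _] E.
have dG0 : 0 <= dG c.
  have := powR_tangent q1 b0 (le_trans b0 bc).
  by rewrite /dG; nra.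
have : 0 <= dG c * (a - b) by rewrite mulr_ge0 // subr_ge0.
rewrite -E.
have -> : G a = (q + 1) / 2 * ((a - b) * (a `^ q + b `^ q)) - a `^ (q + 1).
  by [].
have -> : G b = (q + 1) / 2 * ((b - b) * (b `^ q + b `^ q)) - b `^ (q + 1).
  by [].
lra.
Qed.

(** For equal signs this is [powR_hermite_hadamard] times |x - y|. For opposite signs the left side
    is already at most (x - y)^2 (|x|^q + |y|^q), and (q + 1) / 2 >= 1. At q = 0 it is an equality,
    with 0^0 = 1. *)
Lemma abs_powR_mean_value (q x y : R) : q = 0 \/ 1 <= q ->
  (x - y) * (x * `|x| `^ q - y * `|y| `^ q) <=
  (q + 1) / 2 * ((x - y) ^+ 2 * (`|x| `^ q + `|y| `^ q)).
Proof.
case=> [->|q1]; first by rewrite !powRr0 le_eqVlt; apply/orP; left; apply/eqP; field.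
wlog yx : x y / y <= x => [H|].
  have [/H//|/ltW/H] := leP y x.
  by rewrite [(y - x) ^+ 2]sqrrB -[in leRHS]addrC; nra.
have HH (a b : R) : 0 <= b -> b <= a ->
    a * a `^ q - b * b `^ q <= (q + 1) / 2 * ((a - b) * (a `^ q + b `^ q)).
  move=> b0 ba; have := powR_hermite_hadamard q1 b0 ba.
  rewrite -(@mulr_powRB1 _ a (q + 1)); [|exact: le_trans b0 ba|lra].
  rewrite -(@mulr_powRB1 _ b (q + 1)); [|by []|lra].
  by rewrite addrK.
suff : x * `|x| `^ q - y * `|y| `^ q <=
    (q + 1) / 2 * ((x - y) * (`|x| `^ q + `|y| `^ q)).
  move=> h; rewrite -subr_ge0 in yx; have := ler_wpM2l yx h.
  by move=> h'; apply: le_trans h' _; rewrite le_eqVlt; apply/orP; left; apply/eqP; ring.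
have [y0|y0] := leP 0 y.
  by rewrite !ger0_norm ?HH // (le_trans y0).
have [x0|x0] := leP x 0.
  rewrite (ler0_norm x0) (ltr0_norm y0).
  by have := HH (- y) (- x); rewrite oppr_ge0 lerN2 => /(_ x0 yx); nra.
rewrite (gtr0_norm x0) (ltr0_norm y0).
have := powR_ge0 x q; have := powR_ge0 (- y) q.
move: (_ `^ q) (_ `^ q) => u v v0 u0.
have h : x * u - y * v <= (x - y) * (u + v) by nra.
apply: (le_trans h); rewrite ler_peMl //; last by lra.
by apply: mulr_ge0; lra.
Qed.

(** The slope is largest at [K], by [powR_tangent]. For 0 < q < 1 it is unbounded near 0, which the
    disjunction excludes. *)
Lemma abs_powR_lip (q K : R) : q = 0 \/ 1 <= q -> exists L, forall x y,
  `|x| <= K -> `|y| <= K -> `| `|x| `^ q - `|y| `^ q | <= L * `|x - y|.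
Proof.
case=> [->|q1].
  by exists 0 => x y _ _; rewrite !powRr0 subrr normr0 mul0r.
exists (q * K `^ (q - 1)) => x y.
wlog yx : x y / `|y| <= `|x| => [H|xK yK].
  have [/H//|/ltW/H h xK yK] := leP `|y| `|x|.
  by rewrite distrC [in leRHS]distrC h.
have K0 : 0 <= K := le_trans (normr_ge0 _) xK.
rewrite ger0_norm; last first.
  by rewrite subr_ge0 ge0_ler_powR ?nnegrE //; lra.
apply: le_trans (powR_tangent q1 _ _) _ => //.
apply: ler_pM; rewrite ?subr_ge0 //.
- by rewrite mulr_ge0 ?powR_ge0 //; lra.
- rewrite ler_wpM2l //; first lra.
  by rewrite ge0_ler_powR ?nnegrE //; lra.
- exact: lerB_dist.
Qed.

Lemma mul_abs_powR_lip (q K : R) : q = 0 \/ 1 <= q -> exists L, forall x y,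
  `|x| <= K -> `|y| <= K ->
  `| x * `|x| `^ q - y * `|y| `^ q | <= L * `|x - y|.
Proof.
move=> q01; have [L hL] := abs_powR_lip K q01.
exists (K * L + K `^ q) => x y xK yK.
have -> : x * `|x| `^ q - y * `|y| `^ q =
  x * (`|x| `^ q - `|y| `^ q) + `|y| `^ q * (x - y) by ring.
apply: le_trans (ler_normD _ _) _; rewrite mulrDl !normrM.
apply: lerD.
  by rewrite -mulrA ler_pM ?hL.
rewrite ler_wpM2r // ger0_norm ?powR_ge0 // ge0_ler_powR ?nnegrE //.
  by case: q01; lra.
exact: le_trans xK.
Qed.

Lemma sqrt_young (p k b x : R) : 1 <= p -> 0 <= k ->
  k * (b * `|x| `^ (2 * p - 2)) <=
  k `^ p / p * `|Num.sqrt b| `^ (2 * p) + (1 - p^-1) * `|x| `^ (2 * p).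
Proof.
(* [c] is the positive part of [b], as [Num.sqrt] vanishes on negative numbers; it may replace [b]
   on the left, and then Young's inequality applies to [k * c] and x^2. *)
move=> p1 k0; pose c := `|Num.sqrt b| `^ 2.
have c0 : 0 <= c by exact: powR_ge0.
have bc : b <= c.
  rewrite /c powR_mulrn // ger0_norm ?sqrtr_ge0 //.
  have [b0|b0] := leP 0 b; first by rewrite sqr_sqrtr.
  by rewrite (le_trans (ltW b0)) ?sqr_ge0.
have := powR_young p1 (mulr_ge0 k0 c0) (powR_ge0 `|x| 2).
rewrite -!powRrM powRM // /c -powRrM.
rewrite (_ : 2 * (p - 1) = 2 * p - 2); last ring.
rewrite [_ / p]mulrAC mulrA; apply: le_trans; rewrite -mulrA.
by rewrite -mulrA ler_wpM2l // ler_wpM2r // powR_ge0.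
Qed.

End power_inequalities.

(** * Measurable and bounded random matrices *)

Section random_matrices.
Context {R : realType} {d : nat} {disp : measure_display}.
Context {T : measurableType disp}.
Implicit Types (F G : T -> 'M[R[i]]_d).

Definition mxmeasurable F := forall i j,
  measurable_fun [set: T] (fun w => complex.Re (F w i j)) /\
  measurable_fun [set: T] (fun w => complex.Im (F w i j)).

(** Reduces measurability for the generated sigma-algebra to real functions, where sums and products
    are at hand. *)
Lemma mxmeasurableP F :
  mxmeasurable F <-> measurable_fun [set: T] (F : T -> borelmx R d).
Proof.
split=> [mF|mF i j].
  apply: (@measurability _ _ T (borelmx R d) setT F (@mx_cylinders R d)).
    by [].
  move=> _ [C [i [j [B [mB HC]]]] <-].
  have [mRe mIm] := mF i j.
  by case: HC => ->; [exact: mRe|exact: mIm].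
split=> _ B mB; rewrite setTI.
  have := mF measurableT [set M : borelmx R d | B (complex.Re (M i j))].
  rewrite setTI; apply; apply: sub_sigma_algebra.
  by exists i, j, B; split => //; left.
have := mF measurableT [set M : borelmx R d | B (complex.Im (M i j))].
rewrite setTI; apply; apply: sub_sigma_algebra.
by exists i, j, B; split => //; right.
Qed.

Lemma measurable_ext (f g : T -> R) : f =1 g ->
  measurable_fun [set: T] g -> measurable_fun [set: T] f.
Proof. by move=> /funext ->. Qed.

Lemma mxmeasurable_cst M : mxmeasurable (fun=> M).
Proof. by move=> i j; split; exact: measurable_cst. Qed.

Lemma mxmeasurableD F G : mxmeasurable F -> mxmeasurable G ->
  mxmeasurable (fun w => F w + G w).
Proof.
move=> mF mG i j; have [? ?] := mF i j; have [? ?] := mG i j; split.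
  apply: measurable_ext => [w|]; first by rewrite mxE cReD.
  exact: measurable_funD.
apply: measurable_ext => [w|]; first by rewrite mxE cImD.
exact: measurable_funD.
Qed.

Lemma mxmeasurable_sum I (r : seq I) (F : I -> T -> 'M[R[i]]_d) :
  (forall k, mxmeasurable (F k)) -> mxmeasurable (fun w => \sum_(k <- r) F k w).
Proof.
move=> mF; elim: r => [|k r IH].
  by rewrite (_ : (fun w => _) = fun=> 0);
    [exact: mxmeasurable_cst|apply/funext => w; exact: big_nil].
by rewrite (_ : (fun w => _) = fun w => F k w + \sum_(k <- r) F k w);
    [exact: mxmeasurableD|apply/funext => w; exact: big_cons].
Qed.

Lemma mxmeasurableM F G : mxmeasurable F -> mxmeasurable G ->
  mxmeasurable (fun w => F w *m G w).
Proof.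
move=> mF mG i j; split.
  apply: measurable_ext => [w|]; first by rewrite mxE cRe_sum.
  apply: measurable_sum => k.
  have [? ?] := mF i k; have [? ?] := mG k j.
  apply: measurable_ext => [w|]; first by rewrite cReM.
  by apply: measurable_funB; exact: measurable_funM.
apply: measurable_ext => [w|]; first by rewrite mxE cIm_sum.
apply: measurable_sum => k.
have [? ?] := mF i k; have [? ?] := mG k j.
apply: measurable_ext => [w|]; first by rewrite cImM.
by apply: measurable_funD; exact: measurable_funM.
Qed.

Lemma mxmeasurable_adj F : mxmeasurable F -> mxmeasurable (fun w => (F w)^t*).
Proof.
move=> mF i j; have [? ?] := mF j i; split.
  by apply: measurable_ext => [w|]; first by rewrite adjmxE cRe_conj.
apply: measurable_ext => [w|]; first by rewrite adjmxE cIm_conj.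
exact: measurable_funN.
Qed.

Lemma mxmeasurableZ (c : T -> R) F : measurable_fun [set: T] c ->
  mxmeasurable F -> mxmeasurable (fun w => (c w)%:C *: F w).
Proof.
move=> mc mF i j; have [? ?] := mF i j; split.
  apply: measurable_ext => [w|]; first by rewrite mxE cReM /= mul0r subr0.
  exact: measurable_funM.
apply: measurable_ext => [w|]; first by rewrite mxE cImM /= mul0r addr0.
exact: measurable_funM.
Qed.

Lemma measurable_rtr F :
  mxmeasurable F -> measurable_fun [set: T] (fun w => rtr (F w)).
Proof.
move=> mF; rewrite /rtr /mxtrace.
apply: measurable_ext => [w|]; first exact: cRe_sum.
by apply: measurable_sum => k; have [] := mF k k.
Qed.

Lemma measurable_hsq F :
  mxmeasurable F -> measurable_fun [set: T] (fun w => hsq (F w)).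
Proof.
by move=> mF; apply/measurable_rtr/mxmeasurableM => //; exact: mxmeasurable_adj.
Qed.

(** Every preimage is a countable union of fibres of [h]. *)
Lemma measurable_fun_countable (C : countType) (h : T -> C) (u : C -> R) :
  (forall c, measurable (h @^-1` [set c])) ->
  measurable_fun [set: T] (u \o h).
Proof.
move=> mh _ B mB; rewrite setTI.
have -> : (u \o h) @^-1` B =
    \bigcup_c (if u c \in B then h @^-1` [set c] else set0).
  apply/seteqP; split => [w /= Bw|w [c _]].
    by exists (h w) => //; rewrite mem_set.
  by case: ifPn => // /set_mem Bc /= hw; rewrite /= hw.
apply: countable_bigcupT_measurable => // c.
by case: ifP.
Qed.

Definition rnd (m : nat) (x : R) : R := (Num.floor (m.+1%:R * x))%:~R / m.+1%:R.

Lemma rnd_dist m x : `|rnd m x - x| <= m.+1%:R^-1.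
Proof.
have m0 : 0 < m.+1%:R :> R by rewrite ltr0n.
rewrite -(ler_pM2l m0) divff ?gt_eqF // -[X in X * _]gtr0_norm // -normrM.
rewrite mulrBr /rnd mulrC divfK ?gt_eqF //.
have /andP[h1 h2] := floor_itv (m.+1%:R * x).
by rewrite rmorphD /= in h2; rewrite ler_norml; apply/andP; split; lra.
Qed.

Definition rndmx (m : nat) (M : 'M[R[i]]_d) : 'M[R[i]]_d :=
  \matrix_(i, j) (rnd m (complex.Re (M i j)) +i* rnd m (complex.Im (M i j))).

(* [rndmx m] has countable range, so no regularity of [u] is needed. *)
Lemma measurable_rndmx m (u : 'M[R[i]]_d -> R) F :
  mxmeasurable F -> measurable_fun [set: T] (fun w => u (rndmx m (F w))).
Proof.
move=> mF.
(* Integer matrices form a countable type; factoring through them exhibits the countable range. *)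
pose code w : 'M[int]_d * 'M[int]_d :=
  (\matrix_(i, j) Num.floor (m.+1%:R * complex.Re (F w i j)),
   \matrix_(i, j) Num.floor (m.+1%:R * complex.Im (F w i j))).
pose decode (c : 'M[int]_d * 'M[int]_d) : 'M[R[i]]_d :=
  \matrix_(i, j) ((c.1 i j)%:~R / m.+1%:R +i* ((c.2 i j)%:~R / m.+1%:R)).
have -> : (fun w => u (rndmx m (F w))) = (u \o decode) \o code.
  apply/funext => w /=; congr u; apply/matrixP => i j; by rewrite !mxE.
apply: measurable_fun_countable => -[c1 c2].
have mfl (f : T -> R) (z : int) : measurable_fun [set: T] f ->
    measurable [set w | Num.floor (m.+1%:R * f w) = z].
  move=> mf.
  have := measurable_funM (measurable_cst (m.+1%:R : R)) mf.
  move=> /(_ measurableT `[z%:~R, (z + 1)%:~R[%classic).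
  rewrite setTI => /(_ (measurable_itv _)).
  congr measurable; apply/seteqP; split => w /=; rewrite in_itv /= -floor_eq.
    by move=> /eqP.
  by move=> ->.
have -> : code @^-1` [set (c1, c2)] = \bigcap_(ij in [set: 'I_d * 'I_d])
    ([set w | Num.floor (m.+1%:R * complex.Re (F w ij.1 ij.2)) = c1 ij.1 ij.2]
  `&` [set w | Num.floor (m.+1%:R * complex.Im (F w ij.1 ij.2)) = c2 ij.1 ij.2]).
  apply/seteqP; split => [w /= [<- <-] [i j] _ /=|w H /=].
    by rewrite !mxE.
  rewrite /code; congr (_, _); apply/matrixP => i j; rewrite mxE.
    by have [] := H (i, j) I.
  by have [] := H (i, j) I.
apply: fin_bigcap_measurable => // -[i j] _ /=.
by have [? ?] := mF i j; apply: measurableI; exact: mfl.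
Qed.

End random_matrices.

(** * Measurability of the functional calculus *)

Section fcalc_measurable.
Context {R : realType} {d : nat}.
Implicit Types (A B M N : 'M[R[i]]_d).

Lemma hsq_adj M : hsq (M^t*) = hsq M.
Proof. by rewrite /hsq trmxCK rtr_mulC. Qed.

Lemma hsqZ (c : R) M : hsq (c%:C *: M) = c ^+ 2 * hsq M.
Proof.
by rewrite /hsq adjmxZ -scalemxAl -scalemxAr !rtrZ mulrA.
Qed.

Lemma hsqD_le M N : hsq (M + N) <= 2 * hsq M + 2 * hsq N.
Proof.
rewrite !hsqE !mulr_sumr -big_split; apply: ler_sum => i _ /=.
rewrite !mulr_sumr -big_split; apply: ler_sum => j _ /=.
rewrite mxE cReD cImD.
move: (complex.Re _) (complex.Im _) (complex.Re _) (complex.Im _) => a b a' b'.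
have := sqr_ge0 (a - a'); have := sqr_ge0 (b - b').
by rewrite !sqrrD !sqrrN; lra.
Qed.

(* Precomposing with the Hermitian part makes [fcalc f] meaningful, and
   continuous, on all matrices. *)
Definition hpart M : 'M[R[i]]_d := (2^-1 : R)%:C *: (M + M^t*).

Lemma hpart_herm M : hpart M \is hermsymmx.
Proof.
by apply: hermsymmxZ; rewrite hermsymmxE adjmxD trmxCK addrC.
Qed.

Lemma hpart_id M : M \is hermsymmx -> hpart M = M.
Proof.
move=> hM; rewrite /hpart hermsymmx_adj //; apply/matrixP => i j.
by rewrite !mxE; apply: complex_eqP;
  rewrite ?cReM ?cImM ?cReD ?cImD /=; field.
Qed.

Lemma hpartB M N : hpart (M - N) = hpart M - hpart N.
Proof.
by rewrite /hpart adjmxB -scalerBr; congr (_ *: _); rewrite opprD addrACA.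
Qed.

Lemma hsq_hpart M : hsq (hpart M) <= hsq M.
Proof.
rewrite /hpart hsqZ; have := hsqD_le M (M^t*); rewrite hsq_adj => h.
have : 2^-1 ^+ 2 * hsq (M + M^t*) <= 2^-1 ^+ 2 * (2 * hsq M + 2 * hsq M).
  by rewrite ler_wpM2l // exprn_ge0.
by move=> /le_trans; apply; rewrite le_eqVlt; apply/orP; left; apply/eqP; field.
Qed.

Lemma hsq_rndmx m M :
  hsq (rndmx m M - M) <= m.+1%:R^-1 ^+ 2 * (2 * d%:R ^+ 2).
Proof.
rewrite hsqE.
have -> : m.+1%:R^-1 ^+ 2 * (2 * d%:R ^+ 2) =
    \sum_(i < d) \sum_(j < d) (2 * m.+1%:R^-1 ^+ 2) :> R.
  under eq_bigr do rewrite sumr_const card_ord.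
  rewrite sumr_const card_ord; move: (_^-1) => e.
  by rewrite -(mulr_natr (_ *+ d)) -(mulr_natr (2 * e ^+ 2) d); ring.
apply: ler_sum => i _; apply: ler_sum => j _.
rewrite !mxE cReD cImD cReN cImN /= mulr2n mulrDl mul1r.
by apply: lerD; rewrite -real_normK ?num_real // lerXn2r ?nnegrE ?rnd_dist.
Qed.

(** Uniform on each interval [-K, K]: the eigenvalues of a bounded set of Hermitian matrices lie in
    one such interval. *)
Definition locally_lipschitz (f : R -> R) := forall K : R,
  exists L : R, forall x y : R,
    `|x| <= K -> `|y| <= K -> `|f x - f y| <= L * `|x - y|.

Lemma fcalc_rndmx_dist (f : R -> R) M : locally_lipschitz f ->
  exists C : R, forall m,
    hsq (fcalc f (hpart (rndmx m M)) - fcalc f (hpart M)) <=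
    (C * harmonic m) ^+ 2.
Proof.
(* [K] covers the spectra of [hpart M] and of all its roundings: the bound on the squared rounding
   error is largest at m = 0, where it is 2 d^2, and [hsqD_le] combines it with [hpart M]. *)
move=> lf; pose K : R := Num.sqrt (2 * (2 * d%:R ^+ 2) + 2 * hsq (hpart M)).
have [L hL] := lf K; exists (2 * L * d%:R) => m.
have dist : hsq (hpart (rndmx m M) - hpart M) <=
    m.+1%:R^-1 ^+ 2 * (2 * d%:R ^+ 2).
  by rewrite -hpartB (le_trans (hsq_hpart _)) ?hsq_rndmx.
have m1 : m.+1%:R^-1 ^+ 2 <= 1 :> R.
  by rewrite exprn_ile1 // ?invf_le1 ?ltr0n ?ler1n // invr_ge0.
have MK : Num.sqrt (hsq (hpart M)) <= K.
  rewrite ler_wsqrtr // (@le_trans _ _ (2 * hsq (hpart M))) //.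
    by rewrite ler_peMl ?hsq_ge0 // ler1n.
  by rewrite lerDr !mulr_ge0 // sqr_ge0.
have rK : Num.sqrt (hsq (hpart (rndmx m M))) <= K.
  rewrite ler_wsqrtr //.
  have := hsqD_le (hpart (rndmx m M) - hpart M) (hpart M); rewrite subrK.
  move=> /le_trans; apply; rewrite lerD2r ler_pM2l //.
  by rewrite (le_trans dist) // ler_piMl // mulr_ge0 // sqr_ge0.
apply: le_trans (hsq_fcalc_lip (hpart_herm _) (hpart_herm _) rK MK hL) _.
have := ler_wpM2l (sqr_ge0 L) dist; rewrite /harmonic /= => /le_trans; apply.
move: (m.+1%:R^-1) (d%:R) => a c.
have -> : (2 * L * c * a) ^+ 2 = 4 * (L * c * a) ^+ 2 by ring.
have -> : L ^+ 2 * (a ^+ 2 * (2 * c ^+ 2)) = 2 * (L * c * a) ^+ 2 by ring.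
by rewrite ler_wpM2r ?sqr_ge0 // ler_nat.
Qed.

Lemma cvg_harmonic_dist (u : nat -> R) (l C : R) :
  (forall m, (u m - l) ^+ 2 <= (C * harmonic m) ^+ 2) -> u @ \oo --> l.
Proof.
move=> h.
have hC m : `|u m - l| <= `|C| * harmonic m.
  have := h m; rewrite -ler_sqrt ?sqr_ge0 // !sqrtr_sqr normrM.
  by rewrite [`|harmonic m|]ger0_norm ?harmonic_ge0.
have c0 : (fun m => `|C| * harmonic m) @ \oo --> (0 : R).
  by rewrite -[X in _ --> X](mulr0 `|C|); apply: cvgMr; exact: cvg_harmonic.
apply: (@squeeze_cvgr _ _ _ _ (fun m => l - `|C| * harmonic m)
   (fun m => l + `|C| * harmonic m)).
- by near=> m; have := hC m; rewrite ler_norml => /andP[? ?]; apply/andP; split; lra.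
- by rewrite -[X in _ --> X]subr0; apply: cvgB => //; exact: cvg_cst.
- by rewrite -[X in _ --> X]addr0; apply: cvgD => //; exact: cvg_cst.
Unshelve. all: by end_near. Qed.

(** The values at the roundings are measurable because [rndmx m] has countable range, and they
    converge pointwise by the Lipschitz estimate. *)
Lemma mxmeasurable_fcalc (f : R -> R) disp (T : measurableType disp)
    (F : T -> 'M[R[i]]_d) : locally_lipschitz f -> mxmeasurable F ->
  mxmeasurable (fun w => fcalc f (hpart (F w))).
Proof.
move=> lf mF i j; split.
  apply: (@measurable_fun_cvg _ _ _ _ (fun m w =>
    complex.Re (fcalc f (hpart (rndmx m (F w))) i j))).
    move=> m.
    exact: (@measurable_rndmx _ _ _ _ m (fun N => complex.Re (fcalc f (hpart N) i j))).
  move=> w _; have [C hC] := fcalc_rndmx_dist (F w) lf.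
  apply: (@cvg_harmonic_dist _ _ C) => m; apply: le_trans (hC m).
  rewrite -cReN -cReD; have := entry_le_hsq (fcalc f (hpart (rndmx m (F w))) -
    fcalc f (hpart (F w))) i j; rewrite !mxE; apply: le_trans.
  by rewrite lerDl sqr_ge0.
apply: (@measurable_fun_cvg _ _ _ _ (fun m w =>
  complex.Im (fcalc f (hpart (rndmx m (F w))) i j))).
  move=> m.
  exact: (@measurable_rndmx _ _ _ _ m (fun N => complex.Im (fcalc f (hpart N) i j))).
move=> w _; have [C hC] := fcalc_rndmx_dist (F w) lf.
apply: (@cvg_harmonic_dist _ _ C) => m; apply: le_trans (hC m).
rewrite -cImN -cImD; have := entry_le_hsq (fcalc f (hpart (rndmx m (F w))) -
  fcalc f (hpart (F w))) i j; rewrite !mxE; apply: le_trans.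
by rewrite lerDr sqr_ge0.
Qed.

End fcalc_measurable.

(** * Integration of bounded functions and matrices *)

Section bounded_functions.
Context {R : realType} {disp : measure_display} {T : measurableType disp}.
Implicit Types (f g : T -> R).

(** Bounded everywhere rather than almost everywhere, so that the bound survives composition and
    fixing one argument; integrability under [P] is then automatic. *)
Definition bmfun f := measurable_fun [set: T] f /\
  exists C : R, forall w, `|f w| <= C.

Lemma bmfun_cst (c : R) : bmfun (fun=> c).
Proof. by split; [exact: measurable_cst|exists `|c|]. Qed.

Lemma bmfunD f g : bmfun f -> bmfun g -> bmfun (fun w => f w + g w).
Proof.
move=> [mf [Cf hf]] [mg [Cg hg]]; split; first exact: measurable_funD.
by exists (Cf + Cg) => w; rewrite (le_trans (ler_normD _ _)) ?lerD.
Qed.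

Lemma bmfunN f : bmfun f -> bmfun (fun w => - f w).
Proof.
move=> [mf [C hf]]; split; first exact: measurable_funN.
by exists C => w; rewrite normrN.
Qed.

Lemma bmfunB f g : bmfun f -> bmfun g -> bmfun (fun w => f w - g w).
Proof. by move=> hf hg; apply: bmfunD => //; exact: bmfunN. Qed.

Lemma bmfunM f g : bmfun f -> bmfun g -> bmfun (fun w => f w * g w).
Proof.
move=> [mf [Cf hf]] [mg [Cg hg]]; split; first exact: measurable_funM.
by exists (Cf * Cg) => w; rewrite normrM ler_pM.
Qed.

Lemma bmfun_sum I (r : seq I) (f : I -> T -> R) :
  (forall k, bmfun (f k)) -> bmfun (fun w => \sum_(k <- r) f k w).
Proof.
move=> hf; elim: r => [|k r IH].
  rewrite (_ : (fun w => _) = fun=> 0); first exact: bmfun_cst.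
  by apply/funext => w; rewrite big_nil.
rewrite (_ : (fun w => _) = fun w => f k w + \sum_(k <- r) f k w).
  exact: bmfunD.
by apply/funext => w; rewrite big_cons.
Qed.

Lemma eq_bmfun f g : f =1 g -> bmfun g -> bmfun f.
Proof. by move=> /funext ->. Qed.

Context (P : probability T R).

Lemma bmfun_integrable f : bmfun f -> P.-integrable [set: T] (EFin \o f).
Proof.
move=> [mf [C hf]]; apply: measurable_bounded_integrable => //.
  by rewrite (le_lt_trans (probability_le1 _ _)) ?ltry.
exists C; split; first exact: num_real.
by move=> M CM w _ /=; rewrite (le_trans (hf w)) // ltW.
Qed.

Lemma Rint_cst (c : R) : \int[P]_w c = c.
Proof. by rewrite Rintegral_cst //= (@probability_setT _ _ _ P) /= mulr1. Qed.

Lemma RintD f g : bmfun f -> bmfun g ->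
  \int[P]_w (f w + g w) = \int[P]_w f w + \int[P]_w g w.
Proof. by move=> hf hg; rewrite RintegralD //; exact: bmfun_integrable. Qed.

Lemma RintB f g : bmfun f -> bmfun g ->
  \int[P]_w (f w - g w) = \int[P]_w f w - \int[P]_w g w.
Proof. by move=> hf hg; rewrite RintegralB //; exact: bmfun_integrable. Qed.

Lemma RintZ (c : R) f : bmfun f -> \int[P]_w (c * f w) = c * \int[P]_w f w.
Proof. by move=> hf; rewrite RintegralZl //; exact: bmfun_integrable. Qed.

Lemma RintZr (c : R) f : bmfun f -> \int[P]_w (f w * c) = \int[P]_w f w * c.
Proof. by move=> hf; rewrite RintegralZr //; exact: bmfun_integrable. Qed.

Lemma Rint_le f g : bmfun f -> bmfun g -> (forall w, f w <= g w) ->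
  \int[P]_w f w <= \int[P]_w g w.
Proof.
by move=> hf hg fg; apply: le_Rintegral => //; exact: bmfun_integrable.
Qed.

Lemma Rint_sum I (r : seq I) (f : I -> T -> R) : (forall k, bmfun (f k)) ->
  \int[P]_w (\sum_(k <- r) f k w) = \sum_(k <- r) \int[P]_w f k w.
Proof.
move=> hf; elim: r => [|k r IH].
  rewrite big_nil -[RHS](Rint_cst 0).
  by apply: eq_Rintegral => w _; rewrite big_nil.
rewrite big_cons -IH -RintD //; last exact: bmfun_sum.
by apply: eq_Rintegral => w _; rewrite big_cons.
Qed.

End bounded_functions.

Section bounded_matrices.
Context {R : realType} {d : nat} {disp : measure_display}.
Context {T : measurableType disp}.
Implicit Types (F G : T -> 'M[R[i]]_d).

Definition mxbounded F := forall i j,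
  bmfun (fun w => complex.Re (F w i j)) /\
  bmfun (fun w => complex.Im (F w i j)).

Lemma mxbounded_measurable F : mxbounded F -> mxmeasurable F.
Proof. by move=> bF i j; have [[? _] [? _]] := bF i j. Qed.

Lemma mxbounded_hsq F (C : R) :
  mxmeasurable F -> (forall w, hsq (F w) <= C) -> mxbounded F.
Proof.
move=> mF hF i j; have [? ?] := mF i j.
have h w := le_trans (entry_le_hsq (F w) i j) (hF w).
split; split=> //; exists (Num.sqrt C) => w; rewrite -sqrtr_sqr ler_wsqrtr //.
  by rewrite (le_trans _ (h w)) // lerDl sqr_ge0.
by rewrite (le_trans _ (h w)) // lerDr sqr_ge0.
Qed.

Lemma mxbounded_cst M : mxbounded (fun=> M).
Proof. by move=> i j; split; exact: bmfun_cst. Qed.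

Lemma mxboundedD F G : mxbounded F -> mxbounded G ->
  mxbounded (fun w => F w + G w).
Proof.
move=> bF bG i j; have [? ?] := bF i j; have [? ?] := bG i j; split.
  by apply: eq_bmfun => [w|]; [by rewrite mxE cReD|exact: bmfunD].
by apply: eq_bmfun => [w|]; [by rewrite mxE cImD|exact: bmfunD].
Qed.

Lemma mxboundedN F : mxbounded F -> mxbounded (fun w => - F w).
Proof.
move=> bF i j; have [? ?] := bF i j; split.
  by apply: eq_bmfun => [w|]; [by rewrite mxE cReN|exact: bmfunN].
by apply: eq_bmfun => [w|]; [by rewrite mxE cImN|exact: bmfunN].
Qed.

Lemma mxboundedM F G : mxbounded F -> mxbounded G ->
  mxbounded (fun w => F w *m G w).
Proof.
move=> bF bG i j; split.
  apply: eq_bmfun => [w|]; first by rewrite mxE cRe_sum.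
  apply: bmfun_sum => k; have [? ?] := bF i k; have [? ?] := bG k j.
  by apply: eq_bmfun => [w|];
    [by rewrite cReM|apply: bmfunB; exact: bmfunM].
apply: eq_bmfun => [w|]; first by rewrite mxE cIm_sum.
apply: bmfun_sum => k; have [? ?] := bF i k; have [? ?] := bG k j.
by apply: eq_bmfun => [w|]; [by rewrite cImM|apply: bmfunD; exact: bmfunM].
Qed.

Lemma mxbounded_sum I (r : seq I) (F : I -> T -> 'M[R[i]]_d) :
  (forall k, mxbounded (F k)) -> mxbounded (fun w => \sum_(k <- r) F k w).
Proof.
move=> hF; elim: r => [|k r IH].
  rewrite (_ : (fun w => _) = fun=> 0); first exact: mxbounded_cst.
  by apply/funext => w; rewrite big_nil.
rewrite (_ : (fun w => _) = fun w => F k w + \sum_(k <- r) F k w).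
  exact: mxboundedD.
by apply/funext => w; rewrite big_cons.
Qed.

Lemma bmfun_rtr F : mxbounded F -> bmfun (fun w => rtr (F w)).
Proof.
move=> bF; apply: eq_bmfun => [w|]; first by rewrite /rtr /mxtrace cRe_sum.
by apply: bmfun_sum => k; have [] := bF k k.
Qed.

Lemma mxbounded_bound F : mxbounded F -> exists C : R, forall w, hsq (F w) <= C.
Proof.
move=> bF; have : bmfun (fun w => hsq (F w)).
  apply: eq_bmfun => [w|]; first exact: hsqE.
  apply: bmfun_sum => i; apply: bmfun_sum => j; have [? ?] := bF i j.
  by apply: bmfunD; exact: bmfunM.
move=> [_ [C hC]]; exists C => w; rewrite (le_trans _ (hC w)) //.
exact: ler_norm.
Qed.

Context (P : probability T R).

Lemma Re_mx_expectation F i j :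
  complex.Re (mx_expectation P F i j) = \int[P]_w complex.Re (F w i j).
Proof. by rewrite mxE /= expectation.unlock. Qed.

Lemma Im_mx_expectation F i j :
  complex.Im (mx_expectation P F i j) = \int[P]_w complex.Im (F w i j).
Proof. by rewrite mxE /= expectation.unlock. Qed.

Lemma Rint_rtr_mulr F M : mxbounded F ->
  \int[P]_w rtr (F w *m M) = rtr (mx_expectation P F *m M).
Proof.
move=> bF; rewrite /rtr /mxtrace cRe_sum.
under eq_Rintegral do rewrite cRe_sum.
have b1 i k : bmfun (fun w => complex.Re (F w i k) * complex.Re (M k i)).
  by apply: bmfunM; [case: (bF i k)|exact: bmfun_cst].
have b2 i k : bmfun (fun w => complex.Im (F w i k) * complex.Im (M k i)).
  by apply: bmfunM; [case: (bF i k)|exact: bmfun_cst].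
rewrite Rint_sum => [|i]; last first.
  apply: eq_bmfun => [w|]; first by rewrite mxE cRe_sum.
  apply: bmfun_sum => k.
  by apply: eq_bmfun => [w|]; [by rewrite cReM|exact: bmfunB].
apply: eq_bigr => i _; rewrite mxE cRe_sum.
under eq_Rintegral do rewrite mxE cRe_sum.
rewrite Rint_sum => [|k]; last first.
  by apply: eq_bmfun => [w|]; [by rewrite cReM|exact: bmfunB].
apply: eq_bigr => k _; under eq_Rintegral do rewrite cReM.
rewrite RintB // RintZr ?RintZr; [|by case: (bF i k)..].
by rewrite cReM Re_mx_expectation Im_mx_expectation.
Qed.

Lemma Rint_rtr_mull F M : mxbounded F ->
  \int[P]_w rtr (M *m F w) = rtr (M *m mx_expectation P F).
Proof.
move=> bF; rewrite rtr_mulC -Rint_rtr_mulr //.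
by apply: eq_Rintegral => w _; rewrite rtr_mulC.
Qed.

Lemma mx_expectation_herm F : (forall w, F w \is hermsymmx) -> mxbounded F ->
  mx_expectation P F \is hermsymmx.
Proof.
move=> hF bF; rewrite hermsymmxE; apply/eqP/matrixP => i j; rewrite adjmxE.
have e w : F w i j = ((F w j i)^*)%R by rewrite -adjmxE hermsymmx_adj.
apply: complex_eqP; rewrite ?cRe_conj ?cIm_conj.
  rewrite !Re_mx_expectation.
  by apply: eq_Rintegral => w _; rewrite e cRe_conj.
rewrite !Im_mx_expectation -mulN1r -RintZ; last by case: (bF j i).
by apply: eq_Rintegral => w _; rewrite e cIm_conj mulN1r.
Qed.

End bounded_matrices.

(** * Independence *)

Section independent_copy.
Context {R : realType} {d : nat} {disp : measure_display}.
Context {T : measurableType disp} (P : probability T R).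
Implicit Types (A : 'M[R[i]]_d).
Local Notation EE := (mx_expectation P).

(* Integrating the hypothesis over an independent copy of [w] only involves
   products of a function of [w] with a function of the copy, so every cross
   term is killed by the centering of [Y]. *)
Lemma centered_trace_ineq (c : R) (Y F G : T -> 'M[R[i]]_d) :
  mxbounded Y -> mxbounded F -> mxbounded G -> mx_expectation P Y = 0 ->
  (forall w w', rtr ((Y w - Y w') *m (F w - F w')) <=
    c * rtr ((Y w - Y w') *m (Y w - Y w') *m (G w + G w'))) ->
  \int[P]_w rtr (Y w *m F w) <=
  c * \int[P]_w rtr ((Y w *m Y w +
    mx_expectation P (fun w' => Y w' *m Y w')) *m G w).
Proof.
move=> bY bF bG EY h.
have bcst A : @mxbounded R d _ T (fun=> A) by exact: mxbounded_cst.
have bYF := mxboundedM bY bF.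
have bYY := mxboundedM bY bY.
have bYYG := mxboundedM bYY bG.
have bYG := mxboundedM bY bG.
have bGY := mxboundedM bG bY.
set S2 := mx_expectation P (fun w' => Y w' *m Y w').
(* The left side of the hypothesis averaged over [w'] with [w] fixed; the term pairing [Y w'] with
   [F w] has vanished. *)
pose L w := rtr (Y w *m F w) - rtr (Y w *m EE F)
  + \int[P]_w' rtr (Y w' *m F w').
have LE w : \int[P]_w' rtr ((Y w - Y w') *m (F w - F w')) = L w.
  under eq_Rintegral do rewrite rtr_mulBB.
  have b1 := bmfun_rtr (mxboundedM (bcst (Y w)) bF).
  have b2 := bmfun_rtr (mxboundedM (bcst (F w)) bY).
  have b3 := bmfun_rtr bYF.
  have b0 : bmfun (fun _ : T => rtr (Y w *m F w)) by exact: bmfun_cst.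
  have b01 := bmfunB b0 b1.
  rewrite (RintD P (bmfunB b01 b2) b3) (RintB P b01 b2) (RintB P b0 b1) Rint_cst.
  rewrite (Rint_rtr_mull P _ bF) (Rint_rtr_mull P _ bY) EY mulmx0.
  by rewrite /rtr mxtrace0 subr0.
(* The right side averaged in the same way. The square of the copy yields [S2]; the two middle terms
   of the second group are linear in [Y w] and vanish once [w] is integrated too. *)
pose H w := (rtr (Y w *m Y w *m G w) + rtr (S2 *m G w)) +
  (rtr (Y w *m Y w *m EE G) - rtr (Y w *m EE (fun w' => Y w' *m G w'))
   - rtr (Y w *m EE (fun w' => G w' *m Y w'))
   + \int[P]_w' rtr (Y w' *m Y w' *m G w')).
have HE w : \int[P]_w' rtr ((Y w - Y w') *m (Y w - Y w') *m (G w + G w'))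
    = H w.
  under eq_Rintegral do rewrite rtr_sqrB_mulD.
  have b0 : bmfun (fun _ : T => rtr (Y w *m Y w *m G w)) by exact: bmfun_cst.
  have b1 := bmfun_rtr (mxboundedM bY (bcst (G w *m Y w))).
  have b2 := bmfun_rtr (mxboundedM bY (bcst (Y w *m G w))).
  have b3 := bmfun_rtr (mxboundedM bYY (bcst (G w))).
  have b4 := bmfun_rtr (mxboundedM (bcst (Y w *m Y w)) bG).
  have b5 := bmfun_rtr (mxboundedM (bcst (Y w)) bYG).
  have b6 := bmfun_rtr (mxboundedM (bcst (Y w)) bGY).
  have b7 := bmfun_rtr bYYG.
  have b01 := bmfunB b0 b1; have b012 := bmfunB b01 b2.
  have b45 := bmfunB b4 b5; have b456 := bmfunB b45 b6.
  rewrite (RintD P (bmfunD b012 b3) (bmfunD b456 b7)) (RintD P b012 b3).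
  rewrite (RintB P b01 b2) (RintB P b0 b1) Rint_cst (RintD P b456 b7).
  rewrite (RintB P b45 b6) (RintB P b4 b5).
  rewrite (Rint_rtr_mulr P _ bY) (Rint_rtr_mulr P _ bY) (Rint_rtr_mulr P _ bYY).
  rewrite (Rint_rtr_mull P _ bG) (Rint_rtr_mull P _ bYG) (Rint_rtr_mull P _ bGY).
  by rewrite EY !mul0mx /rtr mxtrace0 !subr0.
have bL : bmfun L.
  apply: bmfunD; last exact: bmfun_cst.
  by apply: bmfunB; apply: bmfun_rtr => //; exact: mxboundedM.
have bH : bmfun H.
  apply: bmfunD; first by apply: bmfunD; apply: bmfun_rtr => //; exact: mxboundedM.
  apply: bmfunD; last exact: bmfun_cst.
  by apply: bmfunB; [apply: bmfunB|]; apply: bmfun_rtr; apply: mxboundedM.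
have LH w : L w <= c * H w.
  rewrite -LE -HE -RintZ; last first.
    by apply: bmfun_rtr; apply: mxboundedM; [apply: mxboundedM|];
      apply: mxboundedD => //; apply: mxboundedN.
  apply: Rint_le => [||w']; last exact: h.
  - by apply: bmfun_rtr; apply: mxboundedM; apply: mxboundedD => //; apply: mxboundedN.
  - apply: bmfunM; first exact: bmfun_cst.
    by apply: bmfun_rtr; apply: mxboundedM; [apply: mxboundedM|];
      apply: mxboundedD => //; apply: mxboundedN.
have := Rint_le P bL (bmfunM (bmfun_cst c) bH) LH.
rewrite RintZ //.
(* Exchanging [w] and [w'] pairs the surviving terms, so both sides carry a factor 2 that cancels at
   the end. *)
have -> : \int[P]_w L w = 2 * \int[P]_w rtr (Y w *m F w).
  rewrite /L RintD; last exact: bmfun_cst; last first.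
    by apply: bmfunB; apply: bmfun_rtr => //; exact: mxboundedM.
  rewrite RintB; [|exact: bmfun_rtr|by apply: bmfun_rtr; exact: mxboundedM].
  rewrite Rint_cst Rint_rtr_mulr // EY mul0mx /rtr mxtrace0 subr0; ring.
have -> : \int[P]_w H w =
    2 * \int[P]_w rtr ((Y w *m Y w + S2) *m G w).
  have -> : \int[P]_w rtr ((Y w *m Y w + S2) *m G w) =
      \int[P]_w rtr (Y w *m Y w *m G w) + rtr (S2 *m EE G).
    rewrite -Rint_rtr_mull // -RintD; [|exact: bmfun_rtr|].
      by apply: eq_Rintegral => w _; rewrite mulmxDl rtrD.
    by apply: bmfun_rtr; exact: mxboundedM.
  have b1 := bmfun_rtr bYYG.
  have b2 := bmfun_rtr (mxboundedM (bcst S2) bG).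
  have b3 := bmfun_rtr (mxboundedM bYY (bcst (EE G))).
  have b4 := bmfun_rtr (mxboundedM bY (bcst (EE (fun w' => Y w' *m G w')))).
  have b5 := bmfun_rtr (mxboundedM bY (bcst (EE (fun w' => G w' *m Y w')))).
  rewrite /H RintD; [|exact: bmfunD|].
  2: by apply: bmfunD; [do 2 apply: bmfunB => //|exact: bmfun_cst].
  have b34 := bmfunB b3 b4; have b345 := bmfunB b34 b5.
  rewrite (RintD P b1 b2) (RintD P b345 (bmfun_cst _)).
  rewrite (RintB P b34 b5) (RintB P b3 b4) Rint_cst.
  rewrite (Rint_rtr_mulr P _ bY) (Rint_rtr_mulr P _ bY) (Rint_rtr_mulr P _ bYY).
  rewrite (Rint_rtr_mull P _ bG) EY !mul0mx.
  by rewrite /rtr mxtrace0 !subr0; ring.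
by rewrite mulrCA ler_pM2l.
Qed.

End independent_copy.

Definition mkmfun d d' (T : measurableType d) (U : measurableType d')
    (f : T -> U) (mf : measurable_fun [set: T] f) : {mfun T >-> U} :=
  MeasurableFun.Pack (MeasurableFun.Class (isMeasurableFun.Build _ _ _ _ f mf)).

Section independent_pair.
Context {R : realType} {disp d1 d2 : measure_display}.
Context {T : measurableType disp} (P : probability T R).
Context {U : measurableType d1} {V : measurableType d2}.

Definition indep_pair (Y : T -> U) (S : T -> V) :=
  forall A B, measurable A -> measurable B ->
    P (Y @^-1` A `&` S @^-1` B) = (P (Y @^-1` A) * P (S @^-1` B))%E.

(** By independence the law of (Y, S) is the image of the product measure under (Y z.1, S z.2), so
    Fubini rewrites the integral with the argument of [S] frozen. Bound and positivity are asked at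
    attained values, because the [phi] of the application is unbounded on the whole product. *)
Lemma indep_pair_Rint_ge0 (Y : T -> U) (S : T -> V) (phi : U * V -> R) (C : R) :
  measurable_fun [set: T] Y -> measurable_fun [set: T] S ->
  indep_pair Y S ->
  measurable_fun [set: U * V] phi ->
  (forall w w', `|phi (Y w, S w')| <= C) ->
  (forall w', 0 <= \int[P]_w phi (Y w, S w')) ->
  0 <= \int[P]_w phi (Y w, S w).
Proof.
move=> mY mS ind mphi hC pos.
have preY B : measurable B -> measurable (Y @^-1` B).
  by move=> mB; rewrite -[X in measurable X]setTI; exact: mY.
have preS B : measurable B -> measurable (S @^-1` B).
  by move=> mB; rewrite -[X in measurable X]setTI; exact: mS.
have mYS : measurable_fun [set: T] (fun w => (Y w, S w)).
  exact: measurable_fun_pair.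
have mYS2 : measurable_fun [set: T * T] (fun z => (Y z.1, S z.2)).
  apply: measurable_fun_pair.
    by apply: (measurableT_comp mY); exact: measurable_fst.
  by apply: (measurableT_comp mS); exact: measurable_snd.
pose PP : {measure set (T * T) -> \bar R} := (P \x P)%E.
have PPT : PP [set: T * T] = 1%E.
  have := @product_measure1E _ _ _ _ _ P P setT setT measurableT measurableT.
  rewrite setXTT => e; transitivity (P [set: T] * P [set: T])%E; first exact: e.
  by rewrite -[RHS]mule1; congr (_ * _)%E; exact: probability_setT.
(* [m1] is the joint law and [m2] the law for two independent sample points; both equal the product
   of the marginals. *)
pose m1 : {measure set (U * V) -> \bar R} := distribution P (mkmfun mYS).
have [m2 m2E] : exists m2 : {measure set (U * V) -> \bar R},
    m2 = pushforward PP (fun z => (Y z.1, S z.2)) :> (set (U * V) -> \bar R).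
  by unshelve eexists (pushforward PP (fun z => (Y z.1, S z.2))
    : {measure set (U * V) -> \bar R}).
have bd1 : P.-integrable [set: T] (EFin \o (phi \o (fun w => (Y w, S w)))).
  apply: bmfun_integrable; split; first exact: measurableT_comp.
  by exists C => w; exact: hC.
have bd2 : PP.-integrable [set: T * T]
    (EFin \o (phi \o (fun z => (Y z.1, S z.2)))).
  apply: measurable_bounded_integrable => //.
  - by rewrite PPT ltry.
  - exact: measurableT_comp.
  - exists C; split; first exact: num_real.
    by move=> M CM z _ /=; rewrite (le_trans (hC _ _)) // ltW.
have m12 A : measurable A -> m1 A = m2 A.
  pose n1 : probability U R := distribution P (mkmfun mY).
  pose n2 : probability V R := distribution P (mkmfun mS).
  move=> mA; rewrite -(@product_measure_unique _ _ _ _ _ n1 n2 m1) //.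
  apply: product_measure_unique => // B D mB mD.
  have := @product_measure1E _ _ _ _ _ P P _ _ (preY _ mB) (preS _ mD).
  by move=> <-; rewrite m2E /pushforward; congr (PP _);
      apply/seteqP; split => z.
have E : (\int[P]_w (phi (Y w, S w))%:E =
    \int[P]_w' \int[P]_w (phi (Y w, S w'))%:E)%E.
  have mephi : measurable_fun [set: U * V] (EFin \o phi) by exact/measurable_EFinP.
  have := @integral_pushforward _ _ _ _ _ _ mYS P setT _ mephi bd1 measurableT.
  rewrite preimage_setT => <-.
  have := @integral_pushforward _ _ _ _ _ _ mYS2 PP setT _ mephi bd2 measurableT.
  rewrite preimage_setT => e2.
  transitivity (\int[PP]_z (phi (Y z.1, S z.2))%:E)%E.
    rewrite -e2 -m2E; apply: eq_measure_integral => A mA _; exact: m12.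
  by rewrite -(integral21_prod_meas1 bd2).
rewrite /Rintegral E; apply: fine_ge0; apply: integral_ge0 => w' _.
(* [pos] concerns a [fine] value, which is 0 at infinity; integrability identifies it with the
   integral. *)
have := pos w'; rewrite /Rintegral.
have : P.-integrable [set: T] (EFin \o (fun w => phi (Y w, S w'))).
  apply: bmfun_integrable; split; last by exists C.
  apply: (measurableT_comp mphi); exact: measurable_fun_pair.
move=> /(integrable_fin_num measurableT) /= /fineK {2}<-.
by rewrite lee_fin.
Qed.

End independent_pair.

(** * Independence of one summand from the sum of the others *)

Section independent_sum.
Context {R : realType} {disp : measure_display} {d : nat}.
Context {T : measurableType disp} (P : probability T R).

(** Two finite measures, E -> P(Y_k in A and E) and E -> P(Y_k in A) P(E), agree on the cylinder
    events of the other variables, a pi-system, hence on the sigma-algebra that these generate; the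
    sum of the others is measurable for it. *)
Lemma independent_sum n (Y : 'I_n -> {RV P >-> borelmx R d}) (k : 'I_n) :
  mutually_independent Y ->
  indep_pair P (U := borelmx R d) (V := borelmx R d)
    (Y k) (fun w => \sum_(j < n | j != k) (Y j w : 'M[R[i]]_d)).
Proof.
move=> ind A B mA mB.
pose K : {set 'I_n} := finset.finset (fun j : 'I_n => j != k).
pose G : set (set T) := [set E | exists C : 'I_n -> set (borelmx R d),
  (forall j, measurable (C j)) /\
  E = [set w | forall j, j \in K -> C j (Y j w)]].
have mpre j C : measurable C -> measurable (Y j @^-1` C).
  by move=> mC; rewrite -[X in measurable X]setTI; exact: measurable_funPT.
have EG (C : 'I_n -> set (borelmx R d)) :
    [set w | forall j, j \in K -> C j (Y j w)] =
    \bigcap_(j in [set j | j \in K]) (Y j @^-1` C j).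
  by apply/seteqP; split => w /= h j; exact: h.
have mG : G `<=` measurable.
  move=> _ [C [mC ->]]; rewrite EG; apply: fin_bigcap_measurable => // j _.
  exact: mpre.
have GI : setI_closed G.
  move=> _ _ [C [mC ->]] [D [mD ->]]; exists (fun j => C j `&` D j); split.
    by move=> j; exact: measurableI.
  apply/seteqP; split => w /= => [[h1 h2] j jk|h].
    by split; [exact: h1|exact: h2].
  by split=> j jk; have [] := h j jk.
have indG E : G E -> P (Y k @^-1` A `&` E) = (P (Y k @^-1` A) * P E)%E.
  move=> [C [mC ->]].
  (* Inserting [A] at index [k] makes the event a cylinder over all indices. *)
  pose CA j := if j == k then A else C j.
  have mCA j : measurable (CA j) by rewrite /CA; case: ifP.
  pose J : {set 'I_n} := finset.finset (fun _ : 'I_n => true).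
  have JT j : j \in J by rewrite inE.
  have := ind J CA mCA; rewrite (bigD1 k) //= {2}/CA eqxx => h.
  have h' := ind K C mC.
  rewrite h'; transitivity (P [set w | forall i, i \in J -> CA i (Y i w)]).
    congr (P _); apply/seteqP; split => [w /= []|w /=].
      move=> Aw h1 j _; rewrite /CA; case: eqP => [->//|/eqP jk].
      by apply: h1; rewrite !inE.
    move=> h1; split; first by have := h1 k (JT _); rewrite /CA eqxx.
    move=> j; rewrite !inE => jk; have := h1 j (JT _).
    by rewrite /CA (negbTE jk).
  rewrite h; congr (_ * _)%E; apply: eq_big => j; first by rewrite !inE.
  by move=> /andP[_ jk]; rewrite /CA (negbTE jk).
(* Measurability here is for the sigma-algebra generated by [G] and not for the ambient one. *)
have mS : measurable_fun [set: g_sigma_algebraType G]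
    ((fun w => \sum_(j < n | j != k) (Y j w : 'M[R[i]]_d)) : _ -> borelmx R d).
  apply/mxmeasurableP; rewrite (_ : (fun w => _) =
    fun w => \sum_j (if j != k then (Y j w : 'M[R[i]]_d) else 0)); last first.
    by apply/funext => w; rewrite big_mkcond.
  apply: mxmeasurable_sum => j; case jk : (j != k); last exact: mxmeasurable_cst.
  apply/mxmeasurableP => _ C mC; rewrite setTI.
  apply: sub_sigma_algebra; exists (fun i => if i == j then C else setT); split.
    by move=> i; case: ifP.
  apply/seteqP; split => w /= => [Cw i _|/(_ j)]; first by case: eqP => [->|].
  by rewrite eqxx inE; exact.
have sGB : <<s G >> ((fun w => \sum_(j < n | j != k) (Y j w : 'M[R[i]]_d)) @^-1` B).
  have := mS measurableT B mB; rewrite setTI; exact.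
have mA' := mpre k A mA.
have PA0 : 0 <= fine (P (Y k @^-1` A)) by rewrite fine_ge0.
pose m1 : {measure set T -> \bar R} := mrestr P mA'.
pose m2 : {measure set T -> \bar R} := mscale (NngNum PA0) P.
have m2E E : m2 E = (P (Y k @^-1` A) * P E)%E.
  by rewrite /m2 /= /mscale /= fineK // fin_num_measure.
have GD : [set X | G X /\ X `<=` [set: T]] = G.
  by apply/seteqP; split => X //= [].
have := @g_sigma_algebra_measure_unique_trace _ R T G setT measurableT.
rewrite GD => /(_ mG GI m1 m2) H.
rewrite setIC -m2E -[LHS]/(m1 _); apply: H => //.
- rewrite m2E /m1 /= /mrestr setTI.
  by rewrite -[LHS]mule1; congr (_ * _)%E; rewrite (@probability_setT _ _ _ P).
- by move=> E GE; rewrite m2E /m1 /= /mrestr setIC; exact: indG.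
- rewrite /m1 /= /mrestr setTI (le_lt_trans (probability_le1 _ _)) // ltry //.
Qed.

End independent_sum.

(** * The moment bound *)

Section power_functions.
Context {R : realType}.

Definition absp (q : R) : R -> R := fun x => `|x| `^ q.
Definition sgnp (q : R) : R -> R := fun x => x * `|x| `^ q.
(* This is [b `^ p] for [0 <= b] and [0] for [b < 0], which spares
   [trace_young] a positivity hypothesis on [B]. *)
Definition sqrtp (p : R) : R -> R := fun b => `|Num.sqrt b| `^ (2 * p).

Lemma mul_sgnp (p x : R) : 1 <= p -> x * sgnp (2 * p - 2) x = absp (2 * p) x.
Proof.
move=> p1; rewrite /sgnp /absp mulrA -expr2 -[x ^+ 2]real_normK ?num_real //.
rewrite -(powR_mulrn 2) // -powRD; last first.
  by rewrite addrC subrK mulf_eq0 pnatr_eq0 /= gt_eqF //; lra.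
by rewrite addrC subrK.
Qed.

Lemma locally_lipschitz_absp (q : R) : q = 0 \/ 1 <= q ->
  locally_lipschitz (absp q).
Proof. by move=> q01 K; exact: abs_powR_lip. Qed.

Lemma locally_lipschitz_sgnp (q : R) : q = 0 \/ 1 <= q ->
  locally_lipschitz (sgnp q).
Proof. by move=> q01 K; exact: mul_abs_powR_lip. Qed.

End power_functions.

Section trace_young.
Context {R : realType} {d : nat}.

Lemma rtr_fcalc_ge0 (f : R -> R) (X : 'M[R[i]]_d) : X \is hermsymmx ->
  (forall x, 0 <= f x) -> 0 <= rtr (fcalc f X).
Proof.
move=> hX f0; have [a [b [W [W0 _ _ E]]]] := joint_spectrum hX hX.
rewrite (rtr_fcalcl f X X) E; apply: sumr_ge0 => i _; apply: sumr_ge0 => j _.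
by rewrite mulr1 mulr_ge0.
Qed.

(** Noncommuting [B] and [X] still share one double sum, in which [sqrt_young] applies at each pair
    of eigenvalues. *)
Lemma trace_young (p k : R) (B X : 'M[R[i]]_d) :
  1 <= p -> 0 <= k -> B \is hermsymmx -> X \is hermsymmx ->
  k * rtr (B *m fcalc (absp (2 * p - 2)) X) <=
  k `^ p / p * rtr (fcalc (sqrtp p) B) +
  (1 - p^-1) * rtr (fcalc (absp (2 * p)) X).
Proof.
move=> p1 k0 hB hX; have [a [b [W [W0 _ _ E]]]] := joint_spectrum hB hX.
rewrite -{1}(fcalc_id hB) (rtr_fcalcl _ B X) (rtr_fcalcr _ B X) !E !wsumZ wsumD.
apply: le_wsum => // i j; rewrite mulr1 mul1r; exact: sqrt_young.
Qed.

End trace_young.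

Section bounded_calculus.
Context {R : realType} {d : nat} {disp : measure_display}.
Context {T : measurableType disp}.

Lemma bmfun_comp disp' (T' : measurableType disp') (h : T' -> T) (f : T -> R) :
  measurable_fun [set: T'] h -> bmfun f -> bmfun (fun w => f (h w)).
Proof.
move=> mh [mf [C hC]]; split; first exact: (measurableT_comp mf mh).
by exists C => w; exact: hC.
Qed.

Lemma mxbounded_comp disp' (T' : measurableType disp') (h : T' -> T)
    (F : T -> 'M[R[i]]_d) :
  measurable_fun [set: T'] h -> mxbounded F -> mxbounded (fun w => F (h w)).
Proof.
move=> mh bF i j; have [b1 b2] := bF i j.
by split; [exact: (bmfun_comp mh b1)|exact: (bmfun_comp mh b2)].
Qed.

Lemma mxbounded_fcalc (f : R -> R) (F : T -> 'M[R[i]]_d) :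
  locally_lipschitz f -> mxbounded F ->
  mxbounded (fun w => fcalc f (hpart (F w))).
Proof.
move=> lf bF; have [C hC] := mxbounded_bound bF.
have [L hL] := lf (Num.sqrt C).
(* On spectra bounded by the root of [C], comparison with f(0) bounds |f|; |L| guards against a
   negative [L], and [d] is the squared Hilbert-Schmidt norm of the identity. *)
apply: (@mxbounded_hsq _ _ _ _ _ ((`|f 0| + `|L| * Num.sqrt C) ^+ 2 * d%:R)).
  exact/mxmeasurable_fcalc/mxbounded_measurable.
move=> w; apply: hsq_fcalc_le; first exact: hpart_herm.
move=> x xK; have {}xK : `|x| <= Num.sqrt C.
  by rewrite (le_trans xK) // ler_wsqrtr // (le_trans (hsq_hpart _)).
have := hL x 0 xK; rewrite normr0 sqrtr_ge0 subr0 => /(_ isT) h.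
rewrite -[f x](subrK (f 0)) (le_trans (ler_normD _ _)) // addrC lerD2l.
rewrite (le_trans h) // (le_trans (ler_norm _)) // normrM normr_id.
by rewrite ler_wpM2l.
Qed.

Lemma Rint_ae_ge0 (P : probability T R) (f : T -> R) : bmfun f ->
  {ae P, forall w, 0 <= f w} -> 0 <= \int[P]_w f w.
Proof.
move=> bf f0; have -> : \int[P]_w f w = \int[P]_w `|f w|.
  congr fine; apply: ae_eq_integral => //.
  - by apply/measurable_EFinP; case: bf.
  - by apply/measurable_EFinP/measurableT_comp => //; case: bf.
  - by apply: filterS f0 => w h _; rewrite ger0_norm.
exact: Rintegral_ge0.
Qed.

End bounded_calculus.

Section moment_bound.
Context {R : realType} {d : nat} {disp : measure_display}.
Context {T : measurableType disp} (P : probability T R).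
Context (p : R) (hp : p = 1 \/ 3 / 2 <= p).
Local Notation q := (2 * p - 2).
Local Notation EE := (mx_expectation P).

Let p1 : 1 <= p. Proof. by case: hp => [->//|]; lra. Qed.

Let q01 : q = 0 \/ 1 <= q.
Proof. by case: hp => [->|h]; [left; rewrite mulr1 subrr|right; lra]. Qed.

(** Adding the fixed [s] leaves [Y w - Y w'] unchanged, so [fcalc_mean_value] for [Y w + s] and
    [Y w' + s] gives the hypothesis of [centered_trace_ineq]. *)
Lemma shifted_trace_ineq (Y : T -> 'M[R[i]]_d) (s : 'M[R[i]]_d) :
  mxbounded Y -> (forall w, Y w \is hermsymmx) -> EE Y = 0 ->
  s \is hermsymmx ->
  \int[P]_w rtr (Y w *m fcalc (sgnp q) (hpart (Y w + s))) <=
  (p - 1 / 2) * \int[P]_w rtr ((Y w *m Y w +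
    EE (fun w' => Y w' *m Y w')) *m fcalc (absp q) (hpart (Y w + s))).
Proof.
move=> bY hY EY hs.
have bYs : mxbounded (fun w => Y w + s).
  by apply: mxboundedD => //; exact: mxbounded_cst.
apply: centered_trace_ineq => //.
- by apply: mxbounded_fcalc => //; exact: locally_lipschitz_sgnp.
- by apply: mxbounded_fcalc => //; exact: locally_lipschitz_absp.
move=> w w'; have hYs v : Y v + s \is hermsymmx by exact: hermsymmxD.
rewrite (hpart_id (hYs w)) (hpart_id (hYs w')).
have -> : Y w - Y w' = (Y w + s) - (Y w' + s).
  by rewrite opprD addrACA subrr addr0.
apply: (fcalc_mean_value (hYs w) (hYs w')) => x y.
have -> : p - 1 / 2 = (q + 1) / 2 by field.
exact: abs_powR_mean_value.
Qed.

Lemma independent_trace_ineq (X Y S : T -> 'M[R[i]]_d) :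
  (forall w, X w = Y w + S w) ->
  mxbounded Y -> mxbounded S ->
  (forall w, Y w \is hermsymmx) -> (forall w, S w \is hermsymmx) ->
  EE Y = 0 -> indep_pair P (U := borelmx R d) (V := borelmx R d) Y S ->
  \int[P]_w rtr (Y w *m fcalc (sgnp q) (hpart (X w))) <=
  (p - 1 / 2) * \int[P]_w rtr ((Y w *m Y w +
    EE (fun w' => Y w' *m Y w')) *m fcalc (absp q) (hpart (X w))).
Proof.
move=> /funext -> bY bS hY hS EY ind; set S2 := EE _.
pose f1 (y s : 'M[R[i]]_d) := rtr (y *m fcalc (sgnp q) (hpart (y + s))).
pose f2 (y s : 'M[R[i]]_d) :=
  rtr ((y *m y + S2) *m fcalc (absp q) (hpart (y + s))).
have ls := locally_lipschitz_sgnp q01; have la := locally_lipschitz_absp q01.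
have bm1 disp' (T' : measurableType disp') (Y' S' : T' -> 'M[R[i]]_d) :
    mxbounded Y' -> mxbounded S' -> bmfun (fun w => f1 (Y' w) (S' w)).
  move=> b1 b2; apply: bmfun_rtr; apply: mxboundedM => //.
  by apply: mxbounded_fcalc => //; exact: mxboundedD.
have bm2 disp' (T' : measurableType disp') (Y' S' : T' -> 'M[R[i]]_d) :
    mxbounded Y' -> mxbounded S' -> bmfun (fun w => f2 (Y' w) (S' w)).
  move=> b1 b2; apply: bmfun_rtr; apply: mxboundedM.
    by apply: mxboundedD; [exact: mxboundedM|exact: mxbounded_cst].
  by apply: mxbounded_fcalc => //; exact: mxboundedD.
have bf1 := bm1 _ _ _ _ bY bS; have bf2 := bm2 _ _ _ _ bY bS.
pose phi (z : borelmx R d * borelmx R d) : R :=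
  (p - 1 / 2) * f2 z.1 z.2 - f1 z.1 z.2.
rewrite -subr_ge0 -RintZ // -RintB //; last first.
  by apply: bmfunM => //; exact: bmfun_cst.
(* A bound on [phi] uniform in both sample points comes from the closure lemmas applied on
   [T * T]. *)
have b1 := mxbounded_comp (@measurable_fst _ _ T T) bY.
have b2 := mxbounded_comp (@measurable_snd _ _ T T) bS.
have [_ [C hC]] := bmfunB
  (bmfunM (bmfun_cst (p - 1 / 2)) (bm2 _ _ _ _ b1 b2)) (bm1 _ _ _ _ b1 b2).
apply: (@indep_pair_Rint_ge0 _ _ _ _ _ P (borelmx R d) (borelmx R d) Y S phi C)
  => //.
- exact/mxmeasurableP/mxbounded_measurable.
- exact/mxmeasurableP/mxbounded_measurable.
- have m1 : mxmeasurable (fun z : borelmx R d * borelmx R d =>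
      z.1 : 'M[R[i]]_d) by apply/mxmeasurableP; exact: measurable_fst.
  have m2 : mxmeasurable (fun z : borelmx R d * borelmx R d =>
      z.2 : 'M[R[i]]_d) by apply/mxmeasurableP; exact: measurable_snd.
  apply: measurable_funB.
    apply: measurable_funM; first exact: measurable_cst.
    apply: measurable_rtr; apply: mxmeasurableM.
      by apply: mxmeasurableD; [exact: mxmeasurableM|exact: mxmeasurable_cst].
    by apply: mxmeasurable_fcalc => //; exact: mxmeasurableD.
  apply: measurable_rtr; apply: mxmeasurableM => //.
  by apply: mxmeasurable_fcalc => //; exact: mxmeasurableD.
- by move=> w w'; exact: (hC (w, w')).
- move=> w'; have bc := @mxbounded_cst R d _ T (S w').
  have b1' := bm1 _ _ _ _ bY bc; have b2' := bm2 _ _ _ _ bY bc.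
  rewrite /phi /= RintB //; last by apply: bmfunM => //; exact: bmfun_cst.
  by rewrite RintZ // subr_ge0; exact: shifted_trace_ineq.
Qed.

Lemma moment_bound n (A : 'I_n -> 'M[R[i]]_d)
    (Y : 'I_n -> {RV P >-> borelmx R d}) :
  (forall k, A k \is hermsymmx) ->
  (forall k w, (Y k w : 'M[R[i]]_d) \is hermsymmx) ->
  (forall k, mxbounded (Y k : T -> 'M[R[i]]_d)) ->
  mutually_independent Y ->
  (forall k, EE (Y k) = 0) ->
  (forall k, {ae P, forall w, (Y k w : 'M[R[i]]_d) ^+ 2 ≼ A k ^+ 2}) ->
  \int[P]_w rtr (fcalc (absp (2 * p)) (\sum_(k < n) (Y k w : 'M[R[i]]_d))) <=
  (p - 1 / 2) `^ p * rtr (fcalc (sqrtp p)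
    (\sum_(k < n) (A k ^+ 2 + EE (fun w => (Y k w : 'M[R[i]]_d) ^+ 2)))).
Proof.
move=> hA hY bY ind EY YA.
pose y k w : 'M[R[i]]_d := Y k w; pose X w : 'M[R[i]]_d := \sum_(k < n) y k w.
pose S2 k : 'M[R[i]]_d := EE (fun w => y k w *m y k w).
pose B : 'M[R[i]]_d := \sum_(k < n) (A k *m A k + S2 k).
rewrite -/B; have hX w : X w \is hermsymmx by apply: hermsymmx_sum => k _; exact: hY.
have bX : mxbounded X by apply: mxbounded_sum => k; exact: bY.
have bdy k : mxbounded (y k) := bY k.
have hy k w : y k w \is hermsymmx := hY k w.
have bYY k : mxbounded (fun w => y k w *m y k w) := mxboundedM (bdy k) (bdy k).
have hB : B \is hermsymmx.
  apply: hermsymmx_sum => k _; apply: hermsymmxD; first exact: hermsymmx_sqr.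
  by apply: mx_expectation_herm => // w; exact/hermsymmx_sqr/hy.
have ls := locally_lipschitz_sgnp q01; have la := locally_lipschitz_absp q01.
pose F w := fcalc (sgnp q) (hpart (X w)).
pose G w := fcalc (absp q) (hpart (X w)).
have bF : mxbounded F by exact: mxbounded_fcalc.
have bG : mxbounded G by exact: mxbounded_fcalc.
have k0 : 0 <= p - 1 / 2 by have := p1; lra.
(* One factor X of |X|^(2p) = X F(X) is expanded as the sum of the [y k]. *)
have ZE w : rtr (fcalc (absp (2 * p)) (X w)) = \sum_(k < n) rtr (y k w *m F w).
  rewrite -rtr_sum -mulmx_suml -/(X w) /F (hpart_id (hX w)).
  rewrite -{2}(fcalc_id (hX w)).
  by rewrite fcalcM; congr rtr; apply: eq_fcalc => x; rewrite mul_sgnp.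
have bYF k : bmfun (fun w => rtr (y k w *m F w)).
  exact: bmfun_rtr (mxboundedM (bdy k) bF).
have bZ : bmfun (fun w => rtr (fcalc (absp (2 * p)) (X w))).
  by apply: eq_bmfun => [w|]; [exact: ZE|exact: bmfun_sum].
have bYG k : bmfun (fun w => rtr ((y k w *m y k w + S2 k) *m G w)).
  apply/bmfun_rtr/mxboundedM => //.
  by apply: mxboundedD => //; exact: mxbounded_cst.
have bAG k : bmfun (fun w => rtr ((A k *m A k + S2 k) *m G w)).
  by apply/bmfun_rtr/mxboundedM => //; exact: mxbounded_cst.
set z := \int[P]_w _.
have step1 : z <= (p - 1 / 2) *
    \sum_(k < n) \int[P]_w rtr ((A k *m A k + S2 k) *m G w).
  have -> : z = \sum_(k < n) \int[P]_w rtr (y k w *m F w).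
    by rewrite -Rint_sum //; apply: eq_Rintegral => w _; exact: ZE.
  rewrite mulr_sumr; apply: ler_sum => k _.
  have XE w : X w = y k w + \sum_(j < n | j != k) y j w.
    by rewrite /X (bigD1 k).
  have bS : mxbounded (fun w => \sum_(j < n | j != k) y j w).
    rewrite (_ : (fun w => _) = fun w => X w - y k w); last first.
      by apply/funext => w; rewrite XE addrAC subrr add0r.
    by apply: mxboundedD => //; exact/mxboundedN/bdy.
  have hS w : \sum_(j < n | j != k) y j w \is hermsymmx.
    by apply: hermsymmx_sum => j _; exact: hY.
  have := independent_trace_ineq XE (bdy k) bS (hy k) hS (EY k)
    (independent_sum k ind).
  move=> h; apply: (le_trans h); apply: (ler_wpM2l k0).
  (* The domination by [A k] enters here: A_k^2 - Y_k^2 is almost surely positive semidefinite and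
     is paired with psi(X), a function with nonnegative values. *)
  rewrite -subr_ge0 -(RintB P (bAG k) (bYG k)).
  apply: Rint_ae_ge0; first exact: bmfunB.
  have := YA k; apply: filterS => w hw.
  rewrite -rtrB -mulmxBl opprD addrACA subrr addr0.
  by apply: rtr_psd_fcalc => // x; exact: powR_ge0.
have step2 : z <= \int[P]_w ((p - 1 / 2) `^ p / p * rtr (fcalc (sqrtp p) B) +
    (1 - p^-1) * rtr (fcalc (absp (2 * p)) (X w))).
  apply: (le_trans step1); rewrite -Rint_sum // -RintZ; last exact: bmfun_sum.
  apply: Rint_le.
  - by apply: bmfunM; [exact: bmfun_cst|exact: bmfun_sum].
  - apply: bmfunD; first exact: bmfun_cst.
    by apply: bmfunM => //; exact: bmfun_cst.
  - move=> w; rewrite -rtr_sum -mulmx_suml -/B /G (hpart_id (hX w)).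
    exact: (trace_young p1 k0 hB (hX w)).
rewrite RintD in step2; [|exact: bmfun_cst|by apply: bmfunM => //; exact: bmfun_cst].
rewrite Rint_cst RintZ // -/z in step2.
have pp : 0 < p by have := p1; lra.
(* Multiplied by [p], the bound reads p z <= p z + (K H - z), which is the claim. *)
have := ler_wpM2l (ltW pp) step2; set K := _ `^ p; set H := rtr (fcalc _ B).
have -> : p * (K / p * H + (1 - p^-1) * z) = p * z + (K * H - z).
  by field; rewrite gt_eqF.
by rewrite lerDl subr_ge0.
Qed.

End moment_bound.

(** * Schatten norms as traces of powers *)

Section schatten_norms.
Context {R : realType} {d : nat}.
Implicit Types (X B S : 'M[R[i]]_d).

Lemma mxfun_fcalc (f : R -> R) X : mxfun f X = fcalc f X.
Proof. by rewrite fcalc.unlock. Qed.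

(** Square, root and power are successive functional calculi of [X]; [fcalc_comp] merges them, with
    |x| the root of x * x. *)
Lemma schatten_herm (r : R) X : X \is hermsymmx ->
  schatten r X = (rtr (fcalc (absp r) X)) `^ r^-1.
Proof.
move=> hX; rewrite /schatten /absmx /sqrtmx !mxfun_fcalc hermsymmx_adj //.
have -> : X *m X = fcalc (fun x => x * x) X.
  by rewrite -[in LHS](fcalc_id hX) fcalcM.
rewrite (fcalc_comp (fun x => x * x) _ hX) (fcalc_comp _ _ hX) -/(rtr _).
congr (rtr _ `^ _); apply: eq_fcalc => x.
by rewrite /absp -expr2 sqrtr_sqr.
Qed.

Lemma powR_schatten (r : R) X : r != 0 -> X \is hermsymmx ->
  schatten r X `^ r = rtr (fcalc (absp r) X).
Proof.
move=> r0 hX; rewrite schatten_herm // -powRrM mulVf // powRr1 //.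
by apply: rtr_fcalc_ge0 => // x; exact: powR_ge0.
Qed.

Lemma rtr_fcalcZ (c : R) (f : R -> R) X : X \is hermsymmx ->
  rtr (fcalc (fun x => c * f x) X) = c * rtr (fcalc f X).
Proof.
move=> hX; have [a [b [W [W0 _ _ E]]]] := joint_spectrum hX hX.
rewrite !(rtr_fcalcl _ X X) !E wsumZ.
by apply: eq_wsum => i j; rewrite mulrA.
Qed.

Lemma rtr_sqrtpZ (p c : R) S : 0 <= c -> S \is hermsymmx ->
  rtr (fcalc (sqrtp p) (c%:C *: S)) = c `^ p * rtr (fcalc (sqrtp p) S).
Proof.
move=> c0 hS; rewrite (fcalcZ c hS) (fcalc_comp _ _ hS) -(rtr_fcalcZ _ _ hS).
congr rtr; apply: eq_fcalc => x.
rewrite /sqrtp sqrtrM // normrM powRM //; congr (_ * _).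
by rewrite ger0_norm ?sqrtr_ge0 // powRrM powR_mulrn ?sqrtr_ge0 // sqr_sqrtr.
Qed.

Lemma powR_le_schatten (p c z : R) B : 1 <= p -> 0 <= c -> 0 <= z ->
  B \is hermsymmx -> z <= c `^ p * rtr (fcalc (sqrtp p) B) ->
  z `^ (2 * p)^-1 <= Num.sqrt c * schatten (2 * p) (sqrtmx B).
Proof.
move=> p1 c0 z0 hB zB; have p0 : 0 < p by lra.
have T0 : 0 <= rtr (fcalc (sqrtp p) B).
  by apply: rtr_fcalc_ge0 => // x; exact: powR_ge0.
rewrite /sqrtmx mxfun_fcalc (schatten_herm _ (fcalc_herm _ _)) (fcalc_comp _ _ hB).
rewrite -[fcalc _ B]/(fcalc (sqrtp p) B).
(* The outer root of order 2p turns c^p into the root of c for every [p]. *)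
have -> : Num.sqrt c = (c `^ p) `^ (2 * p)^-1.
  rewrite -powRrM invfM mulrCA divff ?gt_eqF // mulr1 powR12_sqrt //.
rewrite -powRM ?powR_ge0 //.
apply: ge0_ler_powR => //; rewrite ?nnegrE ?mulr_ge0 ?powR_ge0 //.
by rewrite invr_ge0 mulr_ge0 // ltW.
Qed.

End schatten_norms.

(** * From bounded to almost surely bounded matrices *)

Section almost_everywhere.
Context {R : realType} {d : nat} {disp : measure_display}.
Context {T : measurableType disp} (P : probability T R).

Lemma mx_expectation_ae (F G : T -> 'M[R[i]]_d) :
  mxmeasurable F -> mxmeasurable G -> {ae P, forall w, F w = G w} ->
  mx_expectation P F = mx_expectation P G.
Proof.
move=> mF mG FG; apply/matrixP => i j.
have [? ?] := mF i j; have [? ?] := mG i j.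
apply: complex_eqP; rewrite ?Re_mx_expectation ?Im_mx_expectation.
  congr fine; apply: ae_eq_integral => //; try exact/measurable_EFinP.
  by apply: filterS FG => w e _; rewrite e.
congr fine; apply: ae_eq_integral => //; try exact/measurable_EFinP.
by apply: filterS FG => w e _; rewrite e.
Qed.

Lemma mx_expectationZ (f : T -> R) (M : 'M[R[i]]_d) : bmfun f ->
  mx_expectation P (fun w => (f w)%:C *: M) = (\int[P]_w f w)%:C *: M.
Proof.
move=> bf; apply/matrixP => i j; rewrite [RHS]mxE.
apply: complex_eqP; rewrite ?Re_mx_expectation ?Im_mx_expectation.
  rewrite cReZ -RintZr //; apply: eq_Rintegral => w _.
  by rewrite mxE cReZ.
rewrite cImM /= mul0r addr0 -RintZr //; apply: eq_Rintegral => w _.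
by rewrite mxE cImM /= mul0r addr0.
Qed.

(** A positive semidefinite difference has nonnegative trace. This provides the truncation level:
    almost surely, [Y k] is no larger than [A k]. *)
Lemma loewner_sqr_hsq (X A : 'M[R[i]]_d) :
  X \is hermsymmx -> A \is hermsymmx -> X ^+ 2 ≼ A ^+ 2 -> hsq X <= hsq A.
Proof.
move=> hX hA /psdmx_rtr_ge0; rewrite rtrB subr_ge0.
by rewrite /hsq !hermsymmx_adj.
Qed.

End almost_everywhere.

Section moments.
Context {R : realType} {d : nat} {disp : measure_display}.
Context {T : measurableType disp} (P : probability T R).
Context (p : R) (hp : p = 1 \/ 3 / 2 <= p).
Local Notation EE := (mx_expectation P).

(** Extends [moment_bound] to almost surely bounded matrices. The truncation is a fixed measurable
    map applied to each [Y k], so independence persists, and expectations ignore null sets. The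
    witness [z] records that the moment is finite. *)
Lemma ae_moment_bound n (A : 'I_n -> 'M[R[i]]_d)
    (Y : 'I_n -> {RV P >-> borelmx R d}) :
  (forall k, A k \is hermsymmx) ->
  (forall k w, (Y k w : 'M[R[i]]_d) \is hermsymmx) ->
  mutually_independent Y ->
  (forall k, EE (Y k) = 0) ->
  (forall k, {ae P, forall w, (Y k w : 'M[R[i]]_d) ^+ 2 ≼ A k ^+ 2}) ->
  exists z : R, [/\ 0 <= z,
    ('E_P[fun w => rtr (fcalc (absp (2 * p))
       (\sum_(k < n) (Y k w : 'M[R[i]]_d)))] = z%:E)%E,
    \sum_(k < n) (A k ^+ 2 + EE (fun w => (Y k w : 'M[R[i]]_d) ^+ 2))
      \is hermsymmx &
    z <= (p - 1 / 2) `^ p * rtr (fcalc (sqrtp p)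
      (\sum_(k < n) (A k ^+ 2 + EE (fun w => (Y k w : 'M[R[i]]_d) ^+ 2))))].
Proof.
move=> hA hY ind EY YA.
have p1 : 1 <= p by case: hp => [->//|]; lra.
pose K k : set (borelmx R d) := [set M | hsq (M : 'M[R[i]]_d) <= hsq (A k)].
have m_id : mxmeasurable (fun M : borelmx R d => M : 'M[R[i]]_d).
  by apply/mxmeasurableP; exact: measurable_id.
have mK k : measurable (K k).
  have H : measurable_fun [set: borelmx R d] (fun M => hsq (M : 'M[R[i]]_d)).
    exact: measurable_hsq m_id.
  have := H measurableT `]-oo, hsq (A k)]%classic (measurable_itv _).
  by rewrite setTI (_ : _ @^-1` _ = K k).
(* By the almost sure bound, truncating [Y k] only changes it on a null set. *)
pose tau k (M : borelmx R d) : 'M[R[i]]_d :=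
  (\1_(K k) M : R)%:C *: (M : 'M[R[i]]_d).
have mtau k :
    measurable_fun [set: borelmx R d] (tau k : borelmx R d -> borelmx R d).
  apply/mxmeasurableP; apply: mxmeasurableZ m_id.
  exact: measurable_indic.
have tauK k M : hsq (M : 'M[R[i]]_d) <= hsq (A k) -> tau k M = M.
  move=> h; rewrite /tau indicE mem_set //.
  by rewrite -[RHS](scale1r (M : 'M[R[i]]_d)).
have tau_herm k M : (M : 'M[R[i]]_d) \is hermsymmx -> tau k M \is hermsymmx.
  by move=> hM; exact: hermsymmxZ.
have tau_hsq k M : hsq (tau k M) <= hsq (A k).
  rewrite /tau indicE hsqZ; case: (boolP (M \in K k)) => [/set_mem h|_].
    by rewrite expr1n mul1r.
  by rewrite expr0n mul0r hsq_ge0.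
have mY k : mxmeasurable (Y k : T -> 'M[R[i]]_d).
  by apply/mxmeasurableP; exact: measurable_funPT.
pose Y' k : {RV P >-> borelmx R d} :=
  mkmfun (measurableT_comp (mtau k) (measurable_funPT (Y k))).
have Y'E k w : Y' k w = tau k (Y k w) by [].
have mY' k : mxmeasurable (Y' k : T -> 'M[R[i]]_d).
  by apply/mxmeasurableP; exact: measurable_funPT.
have YY' k : {ae P, forall w, (Y k w : 'M[R[i]]_d) = Y' k w}.
  have := YA k; apply: filterS => w h; rewrite Y'E tauK //.
  exact: loewner_sqr_hsq.
have E2 k : EE (fun w => (Y k w : 'M[R[i]]_d) ^+ 2) =
    EE (fun w => (Y' k w : 'M[R[i]]_d) ^+ 2).
  apply: mx_expectation_ae.
  - exact: (mxmeasurableM (mY k) (mY k)).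
  - exact: (mxmeasurableM (mY' k) (mY' k)).
  - by have := YY' k; apply: filterS => w ->.
have bY' k : mxbounded (Y' k : T -> 'M[R[i]]_d).
  apply: (@mxbounded_hsq _ _ _ _ _ (hsq (A k))) => // w.
  exact: tau_hsq.
have hY' k w : (Y' k w : 'M[R[i]]_d) \is hermsymmx by exact: tau_herm.
have lip : locally_lipschitz (absp (2 * p)).
  by apply: locally_lipschitz_absp; right; lra.
pose Z (y : 'I_n -> {RV P >-> borelmx R d}) w :=
  rtr (fcalc (absp (2 * p)) (\sum_(k < n) (y k w : 'M[R[i]]_d))).
have hpartZ (y : 'I_n -> {RV P >-> borelmx R d}) :
    (forall k w, (y k w : 'M[R[i]]_d) \is hermsymmx) ->
    Z y = fun w => rtr (fcalc (absp (2 * p))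
      (hpart (\sum_(k < n) (y k w : 'M[R[i]]_d)))).
  move=> hy; apply/funext => w; rewrite hpart_id //.
  by apply: hermsymmx_sum => k _; exact: hy.
have mZ : measurable_fun [set: T] (Z Y).
  rewrite hpartZ //; apply/measurable_rtr/mxmeasurable_fcalc => //.
  by apply: mxmeasurable_sum => k; exact: mY.
have bZ' : bmfun (Z Y').
  rewrite hpartZ //; apply/bmfun_rtr/mxbounded_fcalc => //.
  by apply: mxbounded_sum => k; exact: bY'.
exists (\int[P]_w Z Y' w); split.
- apply: Rintegral_ge0 => w _; apply: rtr_fcalc_ge0 => [|x].
    by apply: hermsymmx_sum => k _; exact: hY'.
  exact: powR_ge0.
- rewrite expectation.unlock.
  transitivity (\int[P]_w (Z Y' w)%:E)%E.
    apply: ae_eq_integral => //; first exact/measurable_EFinP.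
      by apply/measurable_EFinP; case: bZ'.
    have : {ae P, forall w, forall k, (Y k w : 'M[R[i]]_d) = Y' k w}.
      by apply: filter_forall => k; exact: YY'.
    apply: filterS => w h _; congr (rtr (fcalc _ _))%:E.
    by apply: eq_bigr => k _; exact: h.
  rewrite /Rintegral fineK //.
  exact: integrable_fin_num (bmfun_integrable P bZ').
- apply: hermsymmx_sum => k _; apply: hermsymmxD.
    exact: hermsymmx_sqr.
  rewrite E2; apply: mx_expectation_herm.
    by move=> w; exact/hermsymmx_sqr/hY'.
  exact: (mxboundedM (bY' k) (bY' k)).
under eq_bigr do rewrite E2.
apply: (@moment_bound _ _ _ _ P p hp n A Y' hA hY' bY').
- move=> J C mC; apply: (ind J (fun i => tau i @^-1` C i)) => i.
  rewrite -[X in measurable X]setTI.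
  exact: (mtau i measurableT (C i) (mC i)).
- by move=> k; rewrite -(mx_expectation_ae (mY k) (mY' k) (YY' k)).
- by move=> k; apply: filterS2 (YA k) (YY' k) => w h <-.
Qed.

End moments.

(** * Rademacher series *)

Section rademacher.
Context {R : realType} {d : nat} {disp : measure_display}.
Context {T : measurableType disp} (P : probability T R).

(** A bounded version of [e]: on the null set where [e] is neither 1 nor -1 it is 0, and its
    integral is a difference of two probabilities. *)
Definition rademacher_sign (e : T -> R) (w : T) : R :=
  \1_(e @^-1` [set 1]) w - \1_(e @^-1` [set -1]) w.

Context (e : {RV P >-> R}) (he : rademacher e).

Let D1 : set T := e @^-1` [set 1].
Let D2 : set T := e @^-1` [set -1].

Let mD1 : measurable D1.
Proof. by rewrite -[D1]setTI; exact: measurable_funPT. Qed.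

Let mD2 : measurable D2.
Proof. by rewrite -[D2]setTI; exact: measurable_funPT. Qed.

Let PD1 : P D1 = (1 / 2)%:E. Proof. exact: he.1. Qed.

Let PD2 : P D2 = (1 / 2)%:E. Proof. exact: he.2. Qed.

Let bm_indic (D : set T) : measurable D -> bmfun (\1_D : T -> R).
Proof.
move=> mD; split; first exact: measurable_indic.
by exists 1 => w; rewrite indicE; case: (_ \in _); rewrite ?normr1 ?normr0.
Qed.

Lemma bmfun_rademacher_sign : bmfun (rademacher_sign e).
Proof. by apply: bmfunB; exact: bm_indic. Qed.

Lemma Rint_rademacher_sign : \int[P]_w rademacher_sign e w = 0.
Proof.
rewrite RintB; [|exact: bm_indic..].
rewrite /Rintegral !integral_indic // !setIT.
by transitivity (fine (P D1) - fine (P D2)); rewrite // PD1 PD2 subrr.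
Qed.

(** The events [e = 1] and [e = -1] are disjoint and their probabilities add up to 1. *)
Lemma rademacher_ae : {ae P, forall w, e w = 1 \/ e w = -1}.
Proof.
exists (~` (D1 `|` D2)); split.
- by apply: measurableC; exact: measurableU.
- have D12 : D1 `&` D2 = set0.
    apply/seteqP; split => // w []; rewrite /D1 /D2 /= => -> h.
    by have : (0 : R) < 1 := ltr01; lra.
  have -> : P (~` (D1 `|` D2)) = (1 - P (D1 `|` D2))%E.
    by apply: probability_setC; exact: measurableU.
  have -> : P (D1 `|` D2) = (P D1 + P D2)%E by exact: measureU.
  rewrite PD1 PD2 -EFinD (_ : 1 / 2 + 1 / 2 = 1); last by field.
  by rewrite subrr.
- by move=> w h [h1|h2]; apply: h; [left|right].
Qed.

Lemma rademacher_signE : {ae P, forall w, e w = rademacher_sign e w}.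
Proof.
have := rademacher_ae; apply: filterS => w [h|h].
  rewrite /rademacher_sign !indicE (mem_set (_ : (e @^-1` [set 1]) w)) //.
  rewrite memNset /= ?h ?subr0 // => h'; have : (0 : R) < 1 := ltr01; lra.
rewrite /rademacher_sign !indicE (mem_set (_ : (e @^-1` [set -1]) w)) //.
rewrite memNset /= ?h ?sub0r // => h'; have : (0 : R) < 1 := ltr01; lra.
Qed.

Lemma mxmeasurable_rademacher (A : 'M[R[i]]_d) :
  mxmeasurable (fun w => (e w)%:C *: A).
Proof. by apply: mxmeasurableZ => //; exact: mxmeasurable_cst. Qed.

Lemma mx_expectation_rademacher (A : 'M[R[i]]_d) :
  mx_expectation P (fun w => (e w)%:C *: A) = 0.
Proof.
have bs := bmfun_rademacher_sign.
rewrite (_ : mx_expectation _ _ =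
    mx_expectation P (fun w => (rademacher_sign e w)%:C *: A)).
  by rewrite mx_expectationZ // Rint_rademacher_sign scale0r.
apply: mx_expectation_ae; first exact: mxmeasurable_rademacher.
  by apply: mxmeasurableZ; [case: bs|exact: mxmeasurable_cst].
by have := rademacher_signE; apply: filterS => w {1}->.
Qed.

Lemma rademacher_sqr_ae (A : 'M[R[i]]_d) :
  {ae P, forall w, ((e w)%:C *: A) ^+ 2 = A ^+ 2}.
Proof.
have := rademacher_ae; apply: filterS => w h.
have -> : ((e w)%:C *: A) ^+ 2 = ((e w)%:C * (e w)%:C) *: A ^+ 2.
  rewrite !expr2 -[LHS]/(((e w)%:C *: A) *m ((e w)%:C *: A)).
  by rewrite -scalemxAl -scalemxAr scalerA.
rewrite -rmorphM (_ : e w * e w = 1) ?scale1r //.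
by case: h => ->; rewrite ?mulr1 // mulrNN mulr1.
Qed.

Lemma mx_expectation_rademacher_sqr (A : 'M[R[i]]_d) :
  mx_expectation P (fun w => ((e w)%:C *: A) ^+ 2) = A ^+ 2.
Proof.
have -> : A ^+ 2 = mx_expectation P (fun=> A ^+ 2).
  apply/matrixP => i j.
  by apply: complex_eqP; rewrite ?Re_mx_expectation ?Im_mx_expectation Rint_cst.
apply: mx_expectation_ae; last exact: rademacher_sqr_ae.
  by apply: mxmeasurableM; exact: mxmeasurable_rademacher.
exact: mxmeasurable_cst.
Qed.

End rademacher.

Theorem corollary7p3 (R : realType) (p : R) (hp : p = 1 \/ 3 / 2 <= p)
    (d n : nat) (A : 'I_n -> 'M[R[i]]_d)
    (hA : forall k, A k \is hermsymmx)
    (disp : measure_display) (T : measurableType disp) (P : probability T R) :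
  (forall Y : 'I_n -> {RV P >-> borelmx R d},
     (forall k w, (Y k w : 'M[R[i]]_d) \is hermsymmx) ->
     mutually_independent Y ->
     (forall k, mx_expectation P (Y k) = 0) ->
     (forall k, {ae P, forall w, (Y k w : 'M[R[i]]_d) ^+ 2 ≼ A k ^+ 2}) ->
     (poweR 'E_P[fun w =>
          powR (schatten (2 * p) (\sum_(k < n) (Y k w : 'M[R[i]]_d))) (2 * p)]
        (2 * p)^-1
      <= (Num.sqrt (p - 1 / 2) *
          schatten (2 * p)
            (sqrtmx (\sum_(k < n)
               (A k ^+ 2 +
                mx_expectation P (fun w => (Y k w : 'M[R[i]]_d) ^+ 2)))))%:E)%E)
  /\
  (forall eps : 'I_n -> {RV P >-> R},
     (forall k, rademacher (eps k)) ->
     mutually_independent eps ->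
     (poweR 'E_P[fun w =>
          powR (schatten (2 * p) (\sum_(k < n) (eps k w)%:C *: A k)) (2 * p)]
        (2 * p)^-1
      <= (Num.sqrt (2 * p - 1) *
          schatten (2 * p) (sqrtmx (\sum_(k < n) A k ^+ 2)))%:E)%E).
Proof.
have p1 : 1 <= p by case: hp => [->//|]; lra.
have p0 : 2 * p != 0 by rewrite mulf_neq0 // gt_eqF //; lra.
split=> [Y hY ind EY YA|eps he ind].
  have [z [z0 Ez hB zB]] := ae_moment_bound hp hA hY ind EY YA.
  rewrite (_ : (fun w => _) = fun w => rtr (fcalc (absp (2 * p))
    (\sum_(k < n) (Y k w : 'M[R[i]]_d)))); last first.
    apply/funext => w; apply: (powR_schatten p0).
    by apply: hermsymmx_sum => k _; exact: hY.
  rewrite Ez poweR_EFin lee_fin; apply: powR_le_schatten => //; lra.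
have hS : \sum_(k < n) A k ^+ 2 \is hermsymmx.
  by apply: hermsymmx_sum => k _; exact: hermsymmx_sqr.
have mY k : measurable_fun [set: T]
    ((fun w => (eps k w)%:C *: A k) : T -> borelmx R d).
  exact/mxmeasurableP/mxmeasurable_rademacher.
pose Y k : {RV P >-> borelmx R d} := mkmfun (mY k).
have hY k w : (Y k w : 'M[R[i]]_d) \is hermsymmx
  := hermsymmxZ (eps k w) (hA k).
have indY : mutually_independent Y.
  move=> J C mC.
  (* An event on [Y k] is an event on [eps k], pulled back along x -> x A_k. *)
  apply: (ind J (fun k => [set x : R | C k (x%:C *: A k)])) => k.
  have mA : measurable_fun [set: R] ((fun x => x%:C *: A k) : R -> borelmx R d).
    by apply/mxmeasurableP/mxmeasurableZ => //; exact: mxmeasurable_cst.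
  by rewrite -[X in measurable X]setTI; exact: (mA measurableT (C k) (mC k)).
have EY k : mx_expectation P (Y k) = 0.
  exact: mx_expectation_rademacher (he k) (A k).
have YA k : {ae P, forall w, (Y k w : 'M[R[i]]_d) ^+ 2 ≼ A k ^+ 2}.
  have := rademacher_sqr_ae (he k) (A k); apply: filterS => w e.
  rewrite /loewner_le [X in _ - X]e subrr; split; first exact: hermsymmx0.
  by move=> v; rewrite mulmx0 mul0mx mxE.
have [z [z0 Ez _ zB]] := ae_moment_bound hp hA hY indY EY YA.
(* Since E Y_k^2 = A_k^2, each summand doubles, and (p - 1/2) * 2 = 2 p - 1 is the constant under
   the root. *)
have B2 : \sum_(k < n) (A k ^+ 2 +
    mx_expectation P (fun w => (Y k w : 'M[R[i]]_d) ^+ 2)) =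
    (2 : R)%:C *: \sum_(k < n) A k ^+ 2.
  rewrite scaler_sumr; apply: eq_bigr => k _.
  rewrite (_ : mx_expectation P _ = A k ^+ 2); last first.
    exact: mx_expectation_rademacher_sqr (he k) (A k).
  by rewrite (rmorphD (real_complex R) 1 1) rmorph1 scalerDl scale1r.
rewrite B2 rtr_sqrtpZ // mulrA -powRM // in zB; last lra.
rewrite (_ : (fun w => _) = fun w => rtr (fcalc (absp (2 * p))
  (\sum_(k < n) (Y k w : 'M[R[i]]_d)))); last first.
  apply/funext => w; apply: (powR_schatten p0).
  by apply: hermsymmx_sum => k _; exact: hY.
rewrite Ez poweR_EFin lee_fin.
have -> : 2 * p - 1 = (p - 1 / 2) * 2 by field.
by apply: powR_le_schatten => //; lra.
Qed.
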